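(* Let $d\in\mathbb{N}^+$, $B_0>0$, $\beta=s+r$ with $s\in\mathbb{N}_0$ and $r\in(0,1]$ (so $s=\lfloor\beta\rfloor$), and assume $f\in\mathcal{H}^\beta([0,1]^d,B_0)$. For any $M,N\in\mathbb{N}^+$, there exists a function $\phi_0$ implemented by a ReLU network with width $\mathcal{W}=38(\lfloor\beta\rfloor+1)^2d^{\lfloor\beta\rfloor+1}N\lceil\log_2(8N)\rceil$ and depth $\mathcal{D}=21(\lfloor\beta\rfloor+1)^2M\lceil\log_2(8M)\rceil$ such that $$\vert f(x)-\phi_0(x)\vert\leq 18B_0(\lfloor\beta\rfloor+1)^2d^{\lfloor\beta\rfloor+(\beta\vee1)/2}(NM)^{-2\beta/d}$$ for all $x\in[0,1]^d\setminus\Omega([0,1]^d,K,\delta)$, where $$\Omega([0,1]^d,K,\delta)=\bigcup_{i=1}^d\Big\{x=(x_1,\ldots,x_d)^\top\in[0,1]^d: x_i\in\bigcup_{k=1}^{K-1}(k/K-\delta,\,k/K)\Big\},$$ with $K=\lceil (MN)^{2/d}\rceil$ and $\delta$ an arbitrary number in $(0,1/(3K)]$.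
   Context: Notation: $a\vee b=\max\{a,b\}$; $\lceil a\rceil$ is the smallest integer no less than $a$; $\lfloor\beta\rfloor$ denotes the largest integer STRICTLY smaller than $\beta$; $\mathbb{N}_0$ is the set of non-negative integers. Hölder class: for $\beta=s+r>0$ with $r\in(0,1]$, $s=\lfloor\beta\rfloor\in\mathbb{N}_0$, and finite $B_0>0$, $$\mathcal{H}^\beta([0,1]^d,B_0)=\Big\{f:[0,1]^d\to\mathbb{R}:\ \max_{\Vert\alpha\Vert_1\le s}\Vert\partial^\alpha f\Vert_\infty\le B_0,\ \max_{\Vert\alpha\Vert_1=s}\sup_{x\ne y}\frac{\vert\partial^\alpha f(x)-\partial^\alpha f(y)\vert}{\Vert x-y\Vert_2^r}\le B_0\Big\},$$ where $\alpha\in\mathbb{N}_0^d$, $\partial^\alpha=\partial^{\alpha_1}\cdots\partial^{\alpha_d}$, $\Vert\alpha\Vert_1=\sum_i\alpha_i$. ReLU network: a function $\mathbb{R}^d\to\mathbb{R}$ of the form $\mathcal{L}_\mathcal{D}\circ\sigma\circ\mathcal{L}_{\mathcal{D}-1}\circ\sigma\circ\cdots\circ\sigma\circ\mathcal{L}_0$, where $\sigma(x)=\max(0,x)$ is applied componentwise and $\mathcal{L}_i(x)=W_ix+b_i$ with $W_i\in\mathbb{R}^{p_{i+1}\times p_i}$, $b_i\in\mathbb{R}^{p_{i+1}}$, $p_0=d$, $p_{\mathcal{D}+1}=1$. The depth $\mathcal{D}$ is the number of hidden layers and the width is $\mathcal{W}=\max\{p_1,\ldots,p_\mathcal{D}\}$.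 *)

(* Defs.v *)
From mathcomp Require Import all_boot all_order all_algebra.
From mathcomp Require Import all_classical all_reals all_analysis.

Set Implicit Arguments.
Unset Strict Implicit.
Unset Printing Implicit Defensive.

Import Order.TTheory GRing.Theory Num.Theory.
Import numFieldNormedType.Exports.

Local Open Scope classical_set_scope.
Local Open Scope ring_scope.

Section Rounding.
Context {R : realType}.

(* Used only for nonnegative x, where the absolute value does nothing. *)
Definition natceil (x : R) : nat := `|Num.ceil x|%N.

Definition log2 (x : R) : R := ln x / ln 2.

End Rounding.

Section Holder.
Context {R : realType}.

Definition cube (d : nat) : set 'cV[R]_d :=
  [set x | forall i, 0 <= x i 0 <= 1].

Definition norm2 (d : nat) (x : 'cV[R]_d) : R :=
  Num.sqrt (\sum_i x i 0 ^+ 2).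

Definition dquot (d : nat) (i : 'I_d) (f : 'cV[R]_d -> R) (x : 'cV[R]_d)
    (h : R) : R :=
  (f (x + h *: delta_mx i 0) - f x) / h.

(* Nonzero increments that stay in the cube: a derivative at a point of the
   cube depends only on the values of f on the cube, and is one-sided on the
   faces x_i = 0 and x_i = 1. *)
Definition increments (d : nat) (i : 'I_d) (x : 'cV[R]_d) : set_system R :=
  within [set h | cube (x + h *: delta_mx i 0)] 0^'.

Definition has_partial (d : nat) (i : 'I_d) (f : 'cV[R]_d -> R) : Prop :=
  forall x, cube x -> cvg (dquot i f x @ increments i x).

Definition partial (d : nat) (i : 'I_d) (f : 'cV[R]_d -> R) :
    'cV[R]_d -> R :=
  fun x => lim (dquot i f x @ increments i x).

(* [:: i1; ...; im] stands for the operator d_i1 (d_i2 (... d_im)). *)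
Definition partials (d : nat) (l : seq 'I_d) (f : 'cV[R]_d -> R) :
    'cV[R]_d -> R :=
  foldr (@partial d) f l.

Fixpoint has_partials (d : nat) (l : seq 'I_d) (f : 'cV[R]_d -> R) : Prop :=
  if l is i :: l' then has_partials l' f /\ has_partial i (partials l' f)
  else True.

Definition multi_index (d : nat) := {ffun 'I_d -> nat}.

Definition norm1 (d : nat) (a : multi_index d) : nat := (\sum_i a i)%N.

Definition mseq (d : nat) (a : multi_index d) : seq 'I_d :=
  flatten [seq nseq (a i) i | i <- enum 'I_d].

Definition mpartial (d : nat) (a : multi_index d) (f : 'cV[R]_d -> R) :
    'cV[R]_d -> R :=
  partials (mseq a) f.

Definition has_mpartial (d : nat) (a : multi_index d) (f : 'cV[R]_d -> R) :
    Prop :=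
  has_partials (mseq a) f.

(* The class of order beta = s + r. A function on the cube is represented by a
   function on the whole space, whose values off the cube are irrelevant. *)
Definition holder_class (d s : nat) (r B0 : R) : set ('cV[R]_d -> R) :=
  [set f |
    [/\ forall a : multi_index d, (norm1 a <= s)%N -> has_mpartial a f,
        forall a : multi_index d, (norm1 a <= s)%N ->
          forall x, cube x -> `|mpartial a f x| <= B0
      & forall a : multi_index d, norm1 a = s ->
          forall x y, cube x -> cube y -> x != y ->
            `|mpartial a f x - mpartial a f y| / norm2 (x - y) `^ r <= B0]].

(* The union over i of the points of the cube whose i-th coordinate lies just
   to the left of an interior grid point k/K. *)
Definition trifling_region (d K : nat) (delta : R) : set 'cV[R]_d :=
  \bigcup_(i in [set: 'I_d])
    [set x | cube x /\
      (\bigcup_(k in [set k : nat | (1 <= k <= K.-1)%N])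
         [set y : R | k%:R / K%:R - delta < y < k%:R / K%:R]) (x i 0)].

End Holder.

Arguments cube {R} d.
Arguments holder_class {R} d s r B0.
Arguments trifling_region {R} d K delta.

Section Network.
Context {R : realType}.

(* relu_net p0 [:: p1; ...; pD] is the type of parameters (W_i, b_i), i <= D,
   with W_i of size p_(i+1) x p_i and p_(D+1) = 1. *)
Inductive relu_net : nat -> seq nat -> Type :=
| OutputLayer p of 'M[R]_(1, p) & 'cV[R]_1 : relu_net p [::]
| HiddenLayer p q ps of 'M[R]_(q, p) & 'cV[R]_q & relu_net q ps :
    relu_net p (q :: ps).

Definition relu (p : nat) (x : 'cV[R]_p) : 'cV[R]_p :=
  map_mx (Num.max 0) x.

Fixpoint relu_eval (p : nat) (ps : seq nat) (net : relu_net p ps) :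
    'cV[R]_p -> R :=
  match net in relu_net p _ return 'cV[R]_p -> R with
  | OutputLayer _ W b => fun x => (W *m x + b) 0 0
  | HiddenLayer _ _ _ W b net' => fun x => relu_eval net' (relu (W *m x + b))
  end.

Definition relu_implements (d width depth : nat) (phi : 'cV[R]_d -> R) :
    Prop :=
  exists (ps : seq nat) (net : relu_net d ps),
    [/\ all (leq 1) ps, size ps = depth, (\max_(p <- ps) p)%N = width
      & phi = relu_eval net].

End Network.

(* Main.v *)
Require Import Defs.
From mathcomp Require Import all_boot all_order all_algebra.
From mathcomp Require Import all_classical all_reals all_analysis.
From mathcomp Require Import ring lra zify.

(** The cells of the grid of step [1/K] are merged in pairs, which leaves at most
    [(M N)^2] cells, and on each cell [f] is replaced by its Taylor polynomial at
    the lower corner.  Outside the trifling region ramps of width [delta] are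
    exact step functions, so a network can compute the digits of the index of the
    cell of [x], and from it four digits [p, q < N] and [l1, l2 < M].  Each Taylor
    coefficient is truncated to [P S] bits, with [P = ceil (log2 (8 N))] and
    [S = (s + 1) ceil (log2 (8 M))].  Each of [P] parallel readers selects by
    [(p, q, l1)] a real number whose binary expansion lists the bits for all [l2],
    and extracts its bits one after the other, keeping those of block [l2].
    Products reduce to squares, and [x - x^2] is self-similar under the triangle
    wave with [N + 1] teeth: a layer of [N + 1] neurons divides the error by
    [(N + 1)^2]. *)

Set Implicit Arguments.
Unset Strict Implicit.
Unset Printing Implicit Defensive.

Import Order.TTheory GRing.Theory Num.Theory.
Import numFieldNormedType.Exports.

Local Open Scope classical_set_scope.
Local Open Scope ring_scope.

(** * Networks as iterated affine spans *)

(** The budget shapes the construction: the depth must be free of [N] and the width free of [M],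
    even in logarithms, while each of about [(N M)^2] cells has its own coefficients. Selection
    alone reaches only [N * N * M] table entries: one factor [N] is paid by hinges in [p], the other
    by one neuron per value of [q], and [M] by one layer per value of [l1]. The missing factor [M]
    is gained by storing [M] values in the bits of one entry. The precision, of order [log (N M)]
    bits, obeys the same separation: it is the product of a number of parallel readers of order
    [log N] and a number of bits per reader of order [log M], and a product of such logarithms, kept
    away from 0, dominates their sum. Likewise about [log M] squaring layers, each gaining
    [(N + 1)^2], are accurate to a power of [N * M]. *)

Section Nets.
Context {R : realType} {T : Type}.
Implicit Types (f g h : T -> R) (F G H : seq (T -> R)) (n m W : nat).

(** A neuron is identified with the function it computes on a set [T] of inputs;
    identities between such functions then need to hold on [T] only. *)
Inductive aff H : (T -> R) -> Prop :=
| AffCst c : aff H (fun=> c)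
| AffMem h : h \in H -> aff H h
| AffAdd f g : aff H f -> aff H g -> aff H (fun t => f t + g t)
| AffScale c f : aff H f -> aff H (fun t => c * f t).

Lemma aff_ext H f g : f =1 g -> aff H f -> aff H g.
Proof. by move=> /funext ->. Qed.

Lemma affD H f g : aff H f -> aff H g -> aff H (f \+ g).
Proof. exact: AffAdd. Qed.

Lemma affB H f g : aff H f -> aff H g -> aff H (f \- g).
Proof.
move=> hf hg; have := AffAdd hf (AffScale (-1) hg).
by apply: aff_ext => t /=; rewrite mulN1r.
Qed.

Lemma aff_sum (I : Type) (r : seq I) (P : pred I) H (f : I -> T -> R) :
  (forall i, aff H (f i)) -> aff H (fun t => \sum_(i <- r | P i) f i t).
Proof.
move=> hf; elim: r => [|i r IH].
  by apply: aff_ext (AffCst H 0) => t; rewrite big_nil.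
case Pi : (P i).
  by apply: aff_ext (AffAdd (hf i) IH) => t; rewrite big_cons Pi.
by apply: aff_ext IH => t; rewrite big_cons Pi.
Qed.

Lemma aff_sum_in (I : eqType) (r : seq I) H (f : I -> T -> R) :
  (forall i, i \in r -> aff H (f i)) -> aff H (fun t => \sum_(i <- r) f i t).
Proof.
elim: r => [|i r IH] hf.
  by apply: aff_ext (AffCst H 0) => t; rewrite big_nil.
have hr : aff H (fun t => \sum_(i <- r) f i t).
  by apply: IH => j jr; apply: hf; rewrite in_cons jr orbT.
by apply: aff_ext (AffAdd (hf i (mem_head _ _)) hr) => t; rewrite big_cons.
Qed.

Lemma aff_comp H G f : (forall g, g \in G -> aff H g) -> aff G f -> aff H f.
Proof.
by move=> hG; elim=> *; [exact: AffCst|exact: hG|exact: AffAdd|exact: AffScale].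
Qed.

Lemma aff_mul H f c : aff H f -> aff H (fun t => f t * c).
Proof. by move=> /(AffScale c); apply: aff_ext => t; rewrite mulrC. Qed.

Definition rl g : T -> R := fun t => Num.max 0 (g t).

Lemma rl_id g : (forall t, 0 <= g t) -> rl g = g.
Proof. by move=> g0; apply/funext => t; rewrite /rl max_r. Qed.

(** [n] hidden layers of at most [W] neurons lead from the functions [H] to
    functions among whose affine combinations are all those of [F]. *)
Fixpoint net n W H F : Prop :=
  if n is n'.+1 then
    exists G, [/\ (size G <= W)%N, forall g, g \in G -> aff H g
                & net n' W (map rl G) F]
  else forall f, f \in F -> aff H f.

Lemma net_mono n W W' H F : (W <= W')%N -> net n W H F -> net n W' H F.
Proof.
move=> WW; elim: n H => //= n IH H [G [sG hG hn]].
by exists G; split=> //; [exact: leq_trans sG WW|exact: IH].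
Qed.

Lemma net_in n W H H' F :
  (forall h, h \in H -> aff H' h) -> net n W H F -> net n W H' F.
Proof.
case: n => [|n] /= hH.
  by move=> hF f /hF; apply: aff_comp.
move=> [G [sG hG hn]]; exists G; split=> // g /hG; exact: aff_comp.
Qed.

Lemma net_out n W H F F' :
  (forall f, f \in F' -> aff F f) -> net n W H F -> net n W H F'.
Proof.
move=> hF; elim: n H => /= [|n IH] H.
  by move=> hn f /hF; apply: aff_comp.
by move=> [G [sG hG hn]]; exists G; split=> //; apply: IH.
Qed.

(** The affine map that ends one network merges with the one that begins the next, so depths add
    with no extra layer. *)
Lemma net_comp n m W H F F' :
  net n W H F -> net m W F F' -> net (n + m) W H F'.
Proof.
elim: n H => /= [|n IH] H; first by move=> hF; apply: net_in.
by move=> [G [sG hG hn]] hm; exists G; split=> //; apply: IH.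
Qed.

Lemma net_cat n W W' H F F' :
  net n W H F -> net n W' H F' -> net n (W + W') H (F ++ F').
Proof.
elim: n H => /= [|n IH] H.
  by move=> h1 h2 f; rewrite mem_cat => /orP[/h1|/h2].
move=> H1 H2.
suff K : forall H', (forall h, h \in H -> aff H' h) ->
    exists G, [/\ (size G <= W + W')%N, forall g, g \in G -> aff H' g
                & net n (W + W') (map rl G) (F ++ F')].
  by apply: K => h; apply: AffMem.
move=> H' HH'; case: H1 => G [sG hG hn]; case: H2 => G' [sG' hG' hn'].
exists (G ++ G'); split.
- by rewrite size_cat leq_add.
- move=> g; rewrite mem_cat => /orP[/hG|/hG']; exact: aff_comp.
rewrite map_cat; apply: IH.
- by apply: net_in hn => h hh; apply: AffMem; rewrite mem_cat hh.
- by apply: net_in hn' => h hh; apply: AffMem; rewrite mem_cat hh orbT.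
Qed.

Lemma net_bigcat (I : eqType) (r : seq I) n W H (F : I -> seq (T -> R)) :
  (forall i, i \in r -> net n W H (F i)) ->
  net n (size r * W) H (flatten [seq F i | i <- r]).
Proof.
elim: r => [|i r IH] hF /=.
  elim: n {hF} H => [//|n IH] H /=.
  by exists [::]; split.
rewrite mulSn; apply: net_cat; first exact: hF (mem_head _ _).
by apply: IH => j jr; apply: hF; rewrite in_cons jr orbT.
Qed.

Lemma net1 W H G F : (size G <= W)%N -> (forall g, g \in G -> aff H g) ->
  (forall f, f \in F -> aff (map rl G) f) -> net 1 W H F.
Proof. by move=> *; exists G. Qed.

(** ReLU fixes nonnegative values, so each is kept at the price of one neuron per layer; this is why
    the lists [Cs] carried along below come with nonnegativity. *)
Lemma net_carry n W H F : (forall f, f \in F -> aff H f) ->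
  (forall f, f \in F -> forall t, 0 <= f t) -> (size F <= W)%N -> net n W H F.
Proof.
move=> hF F0 sF; have rF : map rl F = F.
  by rewrite -[RHS]map_id; apply/eq_in_map => f /F0 /rl_id ->.
elim: n H hF => [//|n IH] H hF /=.
by exists F; split=> //; rewrite rF; apply: IH => f; apply: AffMem.
Qed.

Lemma net_loop n k W (F : nat -> seq (T -> R)) :
  (forall j, (j < n)%N -> net k W (F j) (F j.+1)) -> net (n * k) W (F 0) (F n).
Proof.
elim: n => [|n IH] hF; first by rewrite mul0n => f; apply: AffMem.
rewrite mulSn addnC; apply: net_comp (hF n (ltnSn n)).
by apply: IH => j jn; apply: hF; rewrite ltnS ltnW.
Qed.

(** The depth asked for is exact, so a finished network gets lengthened. Its output may be negative
    and is kept as a positive and a negative part, hence [2 <= W]. *)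
Lemma net_pad n k W H f :
  (2 <= W)%N -> net n W H [:: f] -> net (n + k) W H [:: f].
Proof.
move=> W2 hn; apply: (net_comp hn).
case: k => [|k]; first by move=> g; apply: AffMem.
have hf : aff [:: f] f by apply: AffMem; rewrite mem_head.
exists [:: f; fun t => -1 * f t]; split=> //.
  by move=> g; rewrite !inE => /orP[] /eqP ->; [|apply: AffScale].
apply: (@net_out _ _ _ [:: rl f; rl (fun t => -1 * f t)]).
  move=> g; rewrite inE => /eqP ->.
  apply: (@aff_ext _ (rl f \- rl (fun t => -1 * f t))); last first.
    by apply: affB; apply: AffMem; rewrite !inE eqxx ?orbT.
  by move=> t /=; rewrite /rl mulN1r; case: (leP 0 (f t)); case: (leP 0 (- f t)); lra.
apply: net_carry => //.
- by move=> g hg; apply: AffMem.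
- move=> g; rewrite !inE => /orP[] /eqP -> t; rewrite /rl le_max lexx //.
Qed.

Definition coords p (x : T -> 'cV[R]_p) : seq (T -> R) :=
  [seq (fun t => x t i 0) | i <- enum 'I_p].

Lemma coords_mem p (x : T -> 'cV[R]_p) i : (fun t => x t i 0) \in coords x.
Proof. by apply: map_f; rewrite mem_enum. Qed.

Lemma aff_coords p (x : T -> 'cV[R]_p) f : aff (coords x) f ->
  exists (w : 'rV[R]_p) (b : R), forall t, f t = (w *m x t) 0 0 + b.
Proof.
elim=> [c|h /mapP[i _ ->]|f1 f2 _ [w1 [b1 E1]] _ [w2 [b2 E2]]|c f1 _ [w [b E]]].
- by exists 0, c => t; rewrite mul0mx mxE add0r.
- exists (delta_mx 0 i), 0 => t.
  by rewrite addr0 -rowE mxE.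
- exists (w1 + w2), (b1 + b2) => t.
  by rewrite E1 E2 mulmxDl addrACA; congr (_ + _); rewrite [RHS]mxE.
- by exists (c *: w), (c * b) => t; rewrite E -scalemxAl mulrDr; congr (_ + _); rewrite [RHS]mxE.
Qed.

Lemma net_relu_net n W p (x : T -> 'cV[R]_p) f : net n W (coords x) [:: f] ->
  exists nt : relu_net p (nseq n W), forall t, f t = relu_eval nt (x t).
Proof.
elim: n p x => [|n IH] p x /=.
  move=> /(_ f (mem_head _ _)) /aff_coords [w [b E]].
  by exists (OutputLayer w b%:M) => t /=; rewrite E [RHS]mxE !mxE eqxx mulr1n.
move=> [G [sG hG hn]].
(* Layers with fewer than [W] neurons are filled with the zero function, which makes every width
   exactly [W]. *)
have /choice[w /choice[b E]] : forall i : 'I_W, exists (w : 'rV[R]_p), exists b : R,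
    forall t, nth (fun=> 0) G i t = (w *m x t) 0 0 + b.
  move=> i; apply: aff_coords; case: (ltnP i (size G)) => hi.
    by apply: hG; rewrite mem_nth.
  by rewrite nth_default //; apply: AffCst.
pose A : 'M[R]_(W, p) := \matrix_(i, j) w i 0 j.
pose B : 'cV[R]_W := \col_i b i.
pose x' t := relu (A *m x t + B).
have x'E t i : x' t i 0 = rl (nth (fun=> 0) G i) t.
  rewrite /x' !mxE /rl E !mxE; congr (Num.max 0 (_ + _)).
  by apply: eq_bigr => j _; rewrite mxE.
have [nt Ent] : exists nt : relu_net W (nseq n W), forall t, f t = relu_eval nt (x' t).
  apply: IH; apply: net_in hn => h /mapP[g gG ->]; apply: AffMem.
  have iW : (index g G < W)%N by apply: leq_trans sG; rewrite index_mem.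
  have -> : rl g = (fun t => x' t (Ordinal iW) 0).
    by apply/funext => t; rewrite x'E /= nth_index.
  exact: coords_mem.
by exists (HiddenLayer A B nt) => t; rewrite Ent.
Qed.

End Nets.

Lemma relu_implements_nseq (R : realType) (d W D : nat)
    (nt : relu_net (R := R) d (nseq D W)) :
  (0 < W)%N -> (0 < D)%N -> relu_implements W D (relu_eval nt).
Proof.
move=> W0 D0; exists (nseq D W), nt; split=> //.
- by apply/allP => k; rewrite mem_nseq => /andP[_ /eqP ->].
- by rewrite size_nseq.
- case: D D0 {nt} => // D _; rewrite /= big_cons; apply/maxn_idPl.
  by elim: D => [|D IH] /=; rewrite ?big_nil // big_cons geq_max leqnn.
Qed.

(** * Digits and hat functions *)

(** A digit is the number of positive thresholds it reaches; [net_quant] obtains each indicator as a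
    difference of two ramps. *)
Lemma sum_leq_indicator (R : pzSemiRingType) (a k : nat) : (k < a)%N ->
  \sum_(c <- iota 1 a.-1) ((c <= k)%N)%:R = k%:R :> R.
Proof.
case: a => // a; rewrite ltnS /= => ka.
rewrite -natr_sum; congr _%:R.
rewrite -[X in iota 1 X](subnKC ka) iotaD big_cat /=.
rewrite big_seq (eq_bigr (fun=> 1%N)); last first.
  by move=> i; rewrite mem_iota add1n ltnS => /andP[_ ->].
rewrite -big_seq sum1_size size_iota big_seq big1 ?addn0 // => i.
by rewrite mem_iota add1n => /andP[ki _]; rewrite leqNgt ki.
Qed.

Section Gadgets.
Context {R : realType} {T : Type}.
Implicit Types (f g h y z : T -> R) (F G H Cs : seq (T -> R)) (k n m W : nat).

Lemma ramp_step (theta gam y : R) (b : bool) : 0 < gam ->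
  (b -> theta <= y) -> (~~ b -> y <= theta - gam) ->
  b%:R = Num.max 0 ((y - theta) / gam + 1) - Num.max 0 ((y - theta) / gam).
Proof.
move=> g0; case: b => /= [/(_ isT) h _|_ /(_ isT) h].
  have u0 : 0 <= (y - theta) / gam by rewrite divr_ge0 ?subr_ge0 // ltW.
  by rewrite !max_r //; lra.
have u0 : (y - theta) / gam <= -1 by rewrite ler_pdivrMr //; lra.
by rewrite !max_l //; lra.
Qed.

Lemma aff_step H (y : T -> R) (theta gam : R) (b : T -> bool) : 0 < gam ->
  rl (fun t => (y t - theta) / gam + 1) \in H ->
  rl (fun t => (y t - theta) / gam) \in H ->
  (forall t, b t -> theta <= y t) -> (forall t, ~~ b t -> y t <= theta - gam) ->
  aff H (fun t => (b t)%:R).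
Proof.
move=> g0 h1 h2 hb hnb; apply: aff_ext (affB (AffMem h1) (AffMem h2)) => t /=.
by rewrite (ramp_step (b := b t) g0 (hb t) (hnb t)).
Qed.

(** [k t = floor (y t / g)], and [y] avoids the gaps [(c g - gam, c g)], on which
    the ramps approximating a step are not yet constant. *)
Definition spaced (y : T -> R) (k : T -> nat) (g gam : R) : Prop :=
  forall t c, ((c <= k t)%N -> c%:R * g <= y t) /\
              ((k t < c)%N -> y t <= c%:R * g - gam).

(** One layer per radix in [rs], leading digit first. The digit is subtracted from [y], which shifts
    the thresholds by a multiple of [g] and so preserves the gaps, and is added with its weight to
    [acc]. The width follows the largest radix, the range their product. *)
Lemma net_quant W Cs (gam g : R) rs H (y acc : T -> R) (k : T -> nat) :
  0 < gam -> (forall a, a \in rs -> (2 * a + 2 + size Cs <= W)%N) ->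
  (forall t, (k t < \prod_(a <- rs) a)%N) -> spaced y k g gam ->
  aff H y -> aff H acc -> (forall t, 0 <= acc t) ->
  (forall h, h \in Cs -> aff H h) -> (forall h, h \in Cs -> forall t, 0 <= h t) ->
  net (size rs) W H ((fun t => acc t + (k t)%:R) :: Cs).
Proof.
move=> gam0; elim: rs H y acc k => [|a rs IH] H y acc k hW hk hs hy hacc acc0 hC C0.
  move=> f; rewrite inE => /orP[/eqP ->|/hC//].
  by apply: aff_ext hacc => t; have := hk t; rewrite big_nil ltnS leqn0 => /eqP ->;
    rewrite addr0.
set A := (\prod_(b <- rs) b)%N.
have hkA t : (k t < a * A)%N by have := hk t; rewrite big_cons.
pose th (c : nat) : R := (c * A)%:R * g.
pose G := [seq (fun t => (y t - th c) / gam + 1) | c <- iota 1 a.-1] ++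
  [seq (fun t => (y t - th c) / gam) | c <- iota 1 a.-1] ++ [:: y; acc] ++ Cs.
have y0 t : 0 <= y t by have [/(_ (leq0n _))] := hs t 0%N; rewrite mul0r.
have memrl f : f \in G -> aff (map rl G) (rl f).
  by move=> fG; apply: AffMem; apply: map_f.
have memnn f : f \in [:: y; acc] ++ Cs -> aff (map rl G) f.
  move=> fG; have f0 t : 0 <= f t.
    by move: fG; rewrite mem_cat !inE -orbA => /or3P[/eqP->|/eqP->|/C0].
  by rewrite -(rl_id f0); apply: memrl; rewrite /G catA mem_cat fG orbT.
have hdig : aff (map rl G) (fun t => (k t %/ A)%:R).
  have := @aff_sum_in R T _ (iota 1 a.-1) (map rl G)
    (fun c t => ((c <= k t %/ A)%N)%:R).
  move=> /(_ _)/(aff_ext _); apply.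
    move=> t; apply: sum_leq_indicator.
    case: (posnP A) => [A0|A0]; first by have := hkA t; rewrite A0 muln0.
    by rewrite ltn_divLR.
  move=> c hc; apply: (@aff_step _ y (th c) gam _ gam0).
  - by apply/map_f; rewrite mem_cat; apply/orP; left; apply/mapP; exists c.
  - by apply/map_f; rewrite !mem_cat; apply/orP; right; apply/orP; left; apply/mapP; exists c.
  - move=> t hct; have [+ _] := hs t (c * A)%N; apply.
    exact: leq_trans (leq_mul hct (leqnn A)) (leq_trunc_div _ _).
  - move=> t; rewrite -ltnNge => hct; have [_ +] := hs t (c * A)%N; apply.
    case: (posnP A) => [A0|A0]; first by have := hkA t; rewrite A0 muln0.
    by rewrite -ltn_divLR.
exists G; split.
- have := hW a (mem_head _ _); rewrite /G !size_cat !size_map !size_iota /=; lia.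
- move=> f; rewrite !mem_cat !inE => /orP[/mapP[c _ ->]|/orP[/mapP[c _ ->]|]].
  + apply: affD; last exact: AffCst.
    by apply: aff_mul; apply: affB => //; exact: AffCst.
  + by apply: aff_mul; apply: affB => //; exact: AffCst.
  + by move=> /orP[/orP[/eqP->|/eqP->]|/hC].
have kE t : (k t)%:R = (k t %/ A)%:R * A%:R + (k t %% A)%:R :> R.
  by rewrite -natrM -natrD -divn_eq.
apply: (@net_out _ _ _ _ _
   ((fun t => (acc t + (k t %/ A)%:R * A%:R) + (k t %% A)%:R) :: Cs)).
  move=> f hf; apply: AffMem; move: hf; rewrite !in_cons => /orP[/eqP ->|->];
    rewrite ?orbT //.
  by apply/orP; left; apply/eqP/funext => t; rewrite kE addrA.
apply: (IH _ (fun t => y t - (k t %/ A)%:R * (A%:R * g))).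
- by move=> b hb; apply: hW; rewrite in_cons hb orbT.
- move=> t; rewrite ltn_mod lt0n; apply/eqP => A0.
  by have := hkA t; rewrite A0 muln0.
- move=> t c; have [h1 h2] := hs t (k t %/ A * A + c)%N.
  have e1 : (k t %/ A * A + c <= k t)%N = (c <= k t %% A)%N.
    by rewrite {2}(divn_eq (k t) A) leq_add2l.
  have e2 : (k t < k t %/ A * A + c)%N = (k t %% A < c)%N.
    by rewrite {1}(divn_eq (k t) A) ltn_add2l.
  move: h1 h2; rewrite e1 e2 natrD natrM mulrDl -mulrA.
  move: (_ * (_ * g)) (c%:R * g) => u v h1 h2; split=> [/h1|/h2].
    by rewrite lerBrDl.
  by rewrite lerBlDl addrA.
- by apply: affB; [apply: memnn; rewrite !inE eqxx|apply: aff_mul].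
- by apply: affD; [apply: memnn; rewrite !inE eqxx orbT|apply: aff_mul].
- by move=> t; rewrite addr_ge0 // mulr_ge0.
- by move=> h hh; apply: memnn; rewrite mem_cat hh orbT.
- exact: C0.
Qed.

(** Piecewise linear interpolation with kinks at the integers: the hinge at [n] vanishes at every
    [p <= n], so it corrects the value at [n.+1] without disturbing the earlier ones. *)
Lemma hat_coef n (phi : nat -> R) : exists coef : nat -> R, forall p, (p <= n)%N ->
  phi p = phi 0%N + \sum_(c <- iota 0 n) coef c * Num.max 0 (p%:R - c%:R).
Proof.
elim: n => [|n [coef E]].
  by exists (fun=> 0) => p; rewrite leqn0 => /eqP ->; rewrite big_nil addr0.
pose d := phi n.+1 -
  (phi 0%N + \sum_(c <- iota 0 n) coef c * Num.max 0 (n.+1%:R - c%:R)).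
exists (fun c => if c == n then d else coef c) => p.
rewrite -addn1 iotaD big_cat /= big_seq1 add0n eqxx.
have -> : \sum_(c <- iota 0 n) (if c == n then d else coef c) * Num.max 0 (p%:R - c%:R)
   = \sum_(c <- iota 0 n) coef c * Num.max 0 (p%:R - c%:R).
  rewrite big_seq [RHS]big_seq; apply: eq_bigr => c.
  by rewrite mem_iota add0n => /andP[_ cn]; rewrite (ltn_eqF cn).
rewrite addn1 leq_eqVlt => /orP[/eqP ->|pn].
  rewrite [n.+1]lock -lock -addn1 [in X in d * X]natrD [n%:R + _]addrC addrK.
  by rewrite max_r // mulr1 addn1 addrA subrKC.
have pn0 : Num.max 0 (p%:R - n%:R) = 0 :> R by rewrite max_l // subr_le0 ler_nat.
by rewrite pn0 mulr0 addr0; exact: E.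
Qed.

(** The hinges do not depend on [phi]: one bank of [n] neurons serves every lookup table in [p] at
    once. *)
Lemma aff_hat n H (p : T -> nat) (phi : nat -> R) :
  (forall c, (c < n)%N -> rl (fun t => (p t)%:R - c%:R) \in H) ->
  (forall t, (p t <= n)%N) -> aff H (fun t => phi (p t)).
Proof.
move=> hH pn; have [coef E] := hat_coef n phi.
apply: (@aff_ext _ _ _ (fun t => phi 0%N +
    \sum_(c <- iota 0 n) coef c * rl (fun t => (p t)%:R - c%:R) t)).
  by move=> t; rewrite (E _ (pn t)).
apply: affD; first exact: AffCst.
apply: (aff_sum_in (f := fun c t => coef c * rl (fun t => (p t)%:R - c%:R) t)).
by move=> c; rewrite mem_iota => /andP[_ cn]; apply/AffScale/AffMem/hH.
Qed.

End Gadgets.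

(** * Selecting and reading binary expansions *)

Lemma natr_dist_ge1 (R : realDomainType) (i j : nat) : i != j ->
  1 <= `|i%:R - j%:R : R|.
Proof.
move=> ij; wlog lij : i j ij / (j < i)%N => [IH|].
  have [lij|lij|/eqP] := ltngtP i j; last by rewrite (negbTE ij).
    by rewrite distrC; apply: IH; rewrite // eq_sym.
  exact: IH.
by rewrite ger0_norm -natrB ?(ltnW lij) // (ler_nat _ 1) subn_gt0.
Qed.

Lemma max_subr_abs (R : realDomainType) (x y : R) :
  Num.max 0 (x - y) + Num.max 0 (y - x) = `|x - y|.
Proof.
case: (leP y x) => h.
  by rewrite ger0_norm ?subr_ge0 // max_r ?subr_ge0 // max_l ?subr_le0 // addr0.
rewrite distrC gtr0_norm ?subr_gt0 // max_l ?subr_le0 ?ltW //.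
by rewrite max_r ?subr_ge0 ?ltW // add0r.
Qed.

Lemma max_subr_sub (R : realDomainType) (x y : R) :
  Num.max 0 (x - y) - Num.max 0 (y - x) + y = x.
Proof.
case: (leP y x) => h.
  by rewrite max_r ?subr_ge0 // max_l ?subr_le0 // subr0 subrK.
rewrite max_l ?subr_le0 ?ltW //.
by rewrite max_r ?subr_ge0 ?ltW // sub0r opprB subrK.
Qed.

Section Binary.
Context {R : realType}.
Implicit Types (b : nat -> bool) (n m : nat).

Definition binval b n : R := \sum_(i < n) (b i)%:R / 2 ^+ i.+1.

Lemma binval_recl b n : binval b n.+1 = (b 0%N)%:R / 2 + binval (b \o S) n / 2.
Proof.
rewrite /binval big_ord_recl expr1 mulr_suml; congr (_ + _).
by apply: eq_bigr => i _; rewrite /= [in LHS]exprSr invfM mulrA.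
Qed.

(** The margin [(2 ^+ n)^-1] below 1 is what later separates a leading bit 0 from a leading bit 1 by
    a gap. *)
Lemma binval_bound b n : 0 <= binval b n <= 1 - (2 ^+ n)^-1.
Proof.
elim: n b => [|n IH] b; first by rewrite /binval big_ord0 expr0; lra.
rewrite binval_recl exprS invfM; have := IH (b \o S).
by case: (b 0%N) => /=; lra.
Qed.

Lemma binval_cat b m n :
  binval b (m + n) = binval b m + binval (fun i => b (m + i)%N) n / 2 ^+ m.
Proof.
rewrite /binval big_split_ord /=; congr (_ + _).
by rewrite mulr_suml; apply: eq_bigr => i _; rewrite -addnS exprD invfM mulrAC mulrA.
Qed.

Lemma binval_blocks b m n :
  binval b (m * n) = \sum_(i < m) binval (fun j => b (i * n + j)%N) n / 2 ^+ (i * n).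
Proof.
elim: m => [|m IH]; first by rewrite /binval !big_ord0.
by rewrite mulSnr binval_cat IH big_ord_recr.
Qed.

Lemma binary_expansion n (u : R) : 0 <= u <= 1 ->
  exists b, `|u - binval b n| <= (2 ^+ n)^-1.
Proof.
elim: n u => [|n IH] u u01.
  exists xpred0; rewrite /binval big_ord0 subr0 expr0 invr1 ger0_norm; lra.
have [b0 hb0] : exists b0 : bool, 0 <= 2 * u - b0%:R <= 1.
  by case: (leP (1/2) u) => h; [exists true|exists false]; rewrite /=; lra.
have [b hb] := IH _ hb0.
exists (fun i => if i is j.+1 then b j else b0).
rewrite binval_recl /= exprS invfM.
have -> : binval ((fun i => if i is j.+1 then b j else b0) \o S) n = binval b n.
  by apply: eq_bigr.
have -> : u - (b0%:R / 2 + binval b n / 2) = 2^-1 * (2 * u - b0%:R - binval b n) by lra.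
by rewrite normrM ger0_norm ?ler_pM2l // invr_ge0.
Qed.

Lemma sum_block (m n l : nat) (F : nat -> R) : (l < m)%N -> (0 < n)%N ->
  \sum_(i < m * n) (l == (i %/ n)%N)%:R * F i = \sum_(j < n) F (l * n + j)%N.
Proof.
move=> lm n0; rewrite -(big_mkord xpredT (fun i => (l == (i %/ n)%N)%:R * F i)).
have block c : \sum_(c * n <= i < c.+1 * n) (l == (i %/ n)%N)%:R * F i
    = (l == c)%:R * \sum_(j < n) F (c * n + j)%N.
  rewrite mulSn -{1}[(c * n)%N]add0n big_addn addnK big_mkord mulr_sumr.
  apply: eq_bigr => j _.
  by rewrite divnDMl // divn_small // add0n addnC.
rewrite big_nat_mul big_mkord (bigD1 (Ordinal lm)) //= block eqxx mul1r.
rewrite [X in _ + X]big1 ?addr0 // => c; rewrite block => hc.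
by have /negbTE -> : l != c; rewrite ?mul0r // eq_sym.
Qed.

End Binary.

Section Fitting.
Context {R : realType} {T : Type}.
Implicit Types (f g h y z : T -> R) (F G H Cs : seq (T -> R)) (k n m W : nat).

Lemma net1c W H G P F : (size G + size P <= W)%N ->
  (forall g, g \in G -> aff H g) -> (forall g, g \in P -> aff H g) ->
  (forall f, f \in P -> forall t, 0 <= f t) ->
  (forall f, f \in F -> aff (map rl G ++ P) f) -> net 1 W H F.
Proof.
move=> sW hG hP P0 hF; have rP : map rl P = P.
  by rewrite -[RHS]map_id; apply/eq_in_map => f /P0 /rl_id ->.
apply: (@net1 _ _ _ _ (G ++ P)); rewrite ?size_cat ?map_cat ?rP // => g.
by rewrite mem_cat => /orP[/hG|/hP].
Qed.

Lemma rl_ge0 g t : 0 <= rl g t.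
Proof. by rewrite /rl le_max lexx. Qed.

(** A table with [N * N * M] entries is read with width of order [N] in [1 + M] layers: [p] enters
    through a bank of hinges, [q] through one neuron per value [j], and [l] through the layer at
    which the answer joins [acc]. Entries are at most 1 and distinct integers at least 1 apart, so
    subtracting the distances clamps every wrong neuron to 0. *)
Lemma net_fit W N M H Cs (p q l : T -> nat) (a : nat -> nat -> nat -> R) :
  (3 * N + 4 + size Cs <= W)%N ->
  (forall t, (p t < N)%N) -> (forall t, (q t < N)%N) -> (forall t, (l t < M)%N) ->
  (forall i j c, 0 <= a i j c <= 1) ->
  aff H (fun t => (p t)%:R) -> aff H (fun t => (q t)%:R) ->
  aff H (fun t => (l t)%:R) ->
  (forall h, h \in Cs -> aff H h) -> (forall h, h \in Cs -> forall t, 0 <= h t) ->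
  net (1 + M) W H ((fun t => a (p t) (q t) (l t)) :: Cs).
Proof.
move=> hW pN qN lM a01 hp hq hl hC C0.
pose hat (k : T -> nat) := [seq rl (fun t => (k t)%:R - j%:R : R) | j <- iota 0 N].
pose acc c t := if (l t < c)%N then a (p t) (q t) (l t) else 0.
pose zp c := rl (fun t => (l t)%:R - c%:R : R).
pose zm c := rl (fun t => c%:R - (l t)%:R : R).
pose St c := hat p ++ hat q ++ [:: zp c; zm c; acc c] ++ Cs.
have hatP (k : T -> nat) f : f \in hat k -> exists2 j, (j < N)%N & f = rl (fun t => (k t)%:R - j%:R).
  by move=> /mapP[j]; rewrite mem_iota => /andP[_ jN] ->; exists j.
have hatM (k : T -> nat) j : (j < N)%N -> rl (fun t => (k t)%:R - j%:R) \in hat k.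
  by move=> jN; apply/mapP; exists j; rewrite // mem_iota.
have acc_ge0 c t : 0 <= acc c t.
  by rewrite /acc; case: ifP => // _; have /andP[] := a01 (p t) (q t) (l t).
have St0 : net 1 W H (St 0%N).
  apply: (@net1c _ _ ([seq (fun t => (p t)%:R - j%:R) | j <- iota 0 N] ++
    [seq (fun t => (q t)%:R - j%:R) | j <- iota 0 N] ++
    [:: fun t => (l t)%:R - 0%:R; fun t => 0%:R - (l t)%:R]) Cs) => //.
  - by rewrite !size_cat !size_map size_iota /=; lia.
  - move=> g; rewrite !mem_cat !inE => /or3P[/mapP[j _ ->]|/mapP[j _ ->]|/orP[]/eqP->];
      by apply: affB => //; apply: AffCst.
  move=> f; rewrite /St !map_cat -!map_comp => hf.
  (* [acc 0] is identically 0, hence a constant and not a neuron. *)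
  have [->|nf] := eqVneq f (acc 0%N); first exact: AffCst.
  apply: AffMem; move: hf; rewrite !mem_cat !inE (negbTE nf) orbF -!orbA.
  by move=> /or4P[|||/orP[|]] ->; rewrite ?orbT.
have StS c : (c < M)%N -> net 1 W (St c) (St c.+1).
  move=> cM.
  have memz f : f \in [:: zp c; zm c; acc c] -> aff (St c) f.
    by move=> hf; apply: AffMem; rewrite !mem_cat hf !orbT.
  have hz1 : aff (St c) (zp c) by apply: memz; rewrite !inE eqxx.
  have hz2 : aff (St c) (zm c) by apply: memz; rewrite !inE eqxx orbT.
  (* [zp c] and [zm c] serve twice: their sum is the distance from [l] to [c], and their difference
     recovers [l], which is therefore not carried. *)
  have hl' : aff (St c) (fun t => (l t)%:R).
    apply: (@aff_ext _ _ _ ((zp c \- zm c) \+ (fun=> c%:R))).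
      by move=> t; exact: max_subr_sub.
    by apply: affD; [exact: affB|exact: AffCst].
  (* [v j t] is positive only if [q t = j] and [l t = c]. *)
  pose v j t := a (p t) j c - `|(q t)%:R - j%:R| - (zp c t + zm c t).
  apply: (@net1c _ _ ([:: fun t => (l t)%:R - c.+1%:R; fun t => c.+1%:R - (l t)%:R] ++
     [seq v j | j <- iota 0 N]) (hat p ++ hat q ++ [:: acc c] ++ Cs)).
  - by rewrite !size_cat !size_map size_iota /=; lia.
  - move=> g; rewrite !mem_cat !inE => /orP[/orP[]/eqP->|/mapP[j _ ->]].
    + by apply: affB => //; apply: AffCst.
    + by apply: affB => //; apply: AffCst.
    apply: affB; last exact: affD.
    apply: affB.
      apply: (@aff_hat _ _ N _ p (fun i => a i j c)) => [i iN|t]; last exact: ltnW.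
      by rewrite /St !mem_cat hatM.
    apply: (@aff_hat _ _ N _ q (fun i => `|i%:R - j%:R|)) => [i iN|t]; last exact: ltnW.
    by rewrite /St !mem_cat hatM ?orbT.
  - move=> g hg; apply: AffMem; move: hg; rewrite !mem_cat !inE.
    by move=> /or4P[] ->; rewrite ?orbT.
  - move=> f; rewrite !mem_cat !inE => /or4P[/hatP[j _ ->]|/hatP[j _ ->]|/eqP->|/C0//] t //;
      exact: rl_ge0.
  rewrite map_cat; set P := (X in aff X).
  move=> f; rewrite /St mem_cat => /orP[hf|].
    by apply: AffMem; rewrite /P !mem_cat hf ?orbT.
  rewrite mem_cat => /orP[hf|].
    by apply: AffMem; rewrite /P !mem_cat hf ?orbT.
  rewrite mem_cat => /orP[|hf]; last first.
    by apply: AffMem; rewrite /P !mem_cat hf ?orbT.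
  rewrite !inE => /or3P[]/eqP->.
  - by apply: AffMem; rewrite /P !mem_cat /= !inE eqxx ?orbT.
  - by apply: AffMem; rewrite /P !mem_cat /= !inE eqxx ?orbT.
  apply: (@aff_ext _ _ _ (acc c \+ (fun t => \sum_(j <- iota 0 N) rl (v j) t))).
    move=> t; rewrite /= /acc.
    have z2 : zp c t + zm c t = `|(l t)%:R - c%:R| := max_subr_abs _ _.
    have v0 j : (j != q t) || (l t != c) -> rl (v j) t = 0.
      move=> jc; rewrite /rl max_l // /v z2.
      have /andP[_ a1] := a01 (p t) j c.
      have n1 := normr_ge0 ((q t)%:R - j%:R : R).
      have n2 := normr_ge0 ((l t)%:R - c%:R : R).
      case/orP: jc => [jq|lc]; last by have := natr_dist_ge1 R lc; lra.
      by have := natr_dist_ge1 R jq; rewrite distrC; lra.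
    have -> : (l t < c.+1)%N = (l t == c) || (l t < c)%N by rewrite ltnS leq_eqVlt.
    have [ltc|clt|ec] := ltngtP (l t) c => /=.
    - by rewrite big1 ?addr0 // => j _; apply: v0; rewrite (ltn_eqF ltc) orbT.
    - by rewrite big1 ?addr0 // => j _; apply: v0; rewrite (gtn_eqF clt) orbT.
    rewrite add0r (bigD1_seq (q t)) ?mem_iota ?qN ?iota_uniq //= big1 ?addr0; last first.
      by move=> j jq; apply: v0; rewrite jq.
    rewrite /rl /v z2 ec !subrr !normr0 !subr0 max_r //.
    by have /andP[] := a01 (p t) (q t) c.
  apply: affD.
    by apply: AffMem; rewrite /P !mem_cat /= !inE eqxx ?orbT.
  apply: aff_sum_in => j jN; apply: AffMem; rewrite /P !mem_cat.
  by apply/orP; left; apply/orP; right; apply/map_f/map_f.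
apply: net_comp St0 _; rewrite -[M]muln1.
apply: net_out (net_loop StS) => f; rewrite inE => /orP[/eqP->|hf].
  apply: (@aff_ext _ _ _ (acc M)); first by move=> t; rewrite /acc lM.
  by apply: AffMem; rewrite /St !mem_cat !inE eqxx !orbT.
by apply: AffMem; rewrite /St !mem_cat hf !orbT.
Qed.

(** Two layers per bit: the first compares the unread tail [y j] with 1/2, the second drops the
    leading bit by doubling and subtracting it, and adds the bit to [acc] with the weight it has
    inside its own block. *)
Lemma net_extract W M S H Cs (b : T -> nat -> bool) (l : T -> nat) :
  (6 + size Cs <= W)%N -> (0 < S)%N -> (forall t, (l t < M)%N) ->
  aff H (fun t => binval (b t) (M * S)) -> aff H (fun t => (l t)%:R) ->
  (forall h, h \in Cs -> aff H h) -> (forall h, h \in Cs -> forall t, 0 <= h t) ->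
  net (1 + M * S * 2) W H
    ((fun t => binval (fun j => b t (l t * S + j)%N) S : R) :: Cs).
Proof.
move=> hW S0 lM hy hl hC C0; set L := (M * S)%N.
pose y j t : R := binval (fun i => b t (j + i)%N) (L - j).
pose acc j t : R := \sum_(i < j) (l t == (i %/ S)%N)%:R * ((b t i)%:R / 2 ^+ (i %% S)%N.+1).
pose zp j := rl (fun t => (l t)%:R - (j %/ S)%N%:R : R).
pose zm j := rl (fun t => (j %/ S)%N%:R - (l t)%:R : R).
pose St j := [:: y j; zp j; zm j; acc j] ++ Cs.
have y0 j t : 0 <= y j t by have /andP[] := binval_bound (R := R) (fun i => b t (j + i)%N) (L - j).
have acc0 j t : 0 <= acc j t.
  by apply: sumr_ge0 => i _; rewrite mulr_ge0 // divr_ge0 // exprn_ge0.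
have St_ge0 j f : f \in St j -> forall t, 0 <= f t.
  rewrite /St mem_cat !inE => /orP[/or4P[]/eqP->|/C0//] t //;
    exact: rl_ge0.
have St0 : net 1 W H (St 0%N).
  apply: (@net1c _ _ [:: fun t => (l t)%:R - 0%:R; fun t => 0%:R - (l t)%:R]
     (y 0%N :: Cs)).
  - by rewrite /=; lia.
  - by move=> g; rewrite !inE => /orP[]/eqP->; apply: affB => //; apply: AffCst.
  - move=> g; rewrite inE => /orP[/eqP->|/hC//].
    by apply: aff_ext hy => t; rewrite /y subn0.
  - by move=> f; rewrite inE => /orP[/eqP-> t //|/C0].
  move=> f; rewrite /St mem_cat => /orP[|hf]; last first.
    by apply: AffMem; rewrite mem_cat [X in _ || X]in_cons hf !orbT.
  rewrite !inE => /or4P[]/eqP->.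
  - by apply: AffMem; rewrite mem_cat [X in _ || X]in_cons eqxx !orbT.
  - by apply: AffMem; rewrite /zp div0n !inE eqxx.
  - by apply: AffMem; rewrite /zm div0n !inE eqxx orbT.
  - by apply: (aff_ext _ (AffCst _ 0)) => t; rewrite /acc big_ord0.
have StS j : (j < L)%N -> net 2 W (St j) (St j.+1).
  move=> jL; pose gam : R := (2 ^+ L)^-1.
  have gam0 : 0 < gam by rewrite invr_gt0 exprn_gt0.
  have yS t : y j t = (b t j)%:R / 2 + y j.+1 t / 2.
    rewrite /y -(subnSK jL) binval_recl addn0; congr (_ + _ / 2).
    by apply: eq_bigr => i _; rewrite /= addSnnS.
  (* A finite expansion stays away from 1, so after a leading bit 0 the tail [y j] stays [gam] below
     1/2, and ramps of width [gam] compute the bit exactly. *)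
  have yhi t : y j.+1 t / 2 <= 1 / 2 - gam.
    have /andP[_ h] := binval_bound (R := R) (fun i => b t (j.+1 + i)%N) (L - j.+1).
    have : (2 ^+ (L - j.+1).+1)^-1 >= gam.
      by rewrite lef_pV2 ?posrE ?exprn_gt0 // ler_eXn2l ?ltr1n //; lia.
    rewrite exprS invfM; move: h; rewrite -/(y j.+1 t); lra.
  have memSt f : f \in St j -> aff (St j) f by apply: AffMem.
  have hyj : aff (St j) (y j) by apply: memSt; rewrite mem_head.
  apply: (@net_comp _ _ 1 1 _ _ ((fun t => (b t j)%:R) :: St j)).
    apply: (@net1c _ _ [:: fun t => (y j t - 1 / 2) / gam + 1;
       fun t => (y j t - 1 / 2) / gam] (St j)) => //.
    - by move=> g; rewrite !inE => /orP[]/eqP->; [apply: affD; last exact: AffCst|];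
        (apply: aff_mul; apply: affB => //; apply: AffCst).
    - exact: St_ge0.
    move=> f; rewrite inE => /orP[/eqP->|hf]; last first.
      by apply: AffMem; rewrite mem_cat hf orbT.
    apply: (@aff_step _ _ _ (y j) (1/2) gam) => //.
    - by rewrite !inE eqxx.
    - by rewrite !inE eqxx !orbT.
    - by move=> t bt; rewrite yS bt; have := y0 j.+1 t; rewrite /=; lra.
    - by move=> t /negbTE bt; rewrite yS bt; have := yhi t; rewrite /=; lra.
  set H1 := _ :: _.
  have mem1 f : f \in H1 -> aff H1 f by apply: AffMem.
  have hb : aff H1 (fun t => (b t j)%:R) by apply: mem1; rewrite mem_head.
  have hyj1 : aff H1 (y j) by apply: mem1; rewrite !inE eqxx orbT.
  have hzp : aff H1 (zp j) by apply: mem1; rewrite !inE eqxx !orbT.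
  have hzm : aff H1 (zm j) by apply: mem1; rewrite !inE eqxx !orbT.
  have hl1 : aff H1 (fun t => (l t)%:R).
    apply: (@aff_ext _ _ _ ((zp j \- zm j) \+ (fun=> (j %/ S)%N%:R))).
      by move=> t; exact: max_subr_sub.
    by apply: affD; [exact: affB|exact: AffCst].
  (* [rl u] is the bit [b t j] if [j] lies in block [l t], and [0] otherwise. *)
  pose u t := (b t j)%:R - (zp j t + zm j t).
  apply: (@net1c _ _ [:: u; fun t => (l t)%:R - ((j.+1 %/ S)%N)%:R;
      fun t => ((j.+1 %/ S)%N)%:R - (l t)%:R] ([:: y j.+1; acc j] ++ Cs)).
  - by rewrite /= ; lia.
  - move=> g; rewrite !inE => /or3P[]/eqP->.
    + by apply: affB => //; apply: affD.
    + by apply: affB => //; apply: AffCst.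
    + by apply: affB => //; apply: AffCst.
  - move=> g; rewrite mem_cat !inE => /orP[/orP[]/eqP->|hg].
    + apply: (@aff_ext _ _ _ ((fun t => 2 * y j t) \- (fun t => (b t j)%:R))).
        by move=> t /=; rewrite yS; lra.
      by apply: affB => //; apply: AffScale.
    + by apply: mem1; rewrite !inE eqxx !orbT.
    + by apply: mem1; rewrite in_cons mem_cat hg !orbT.
  - by move=> f; rewrite mem_cat !inE => /orP[/orP[]/eqP->|/C0//].
  set H2 := _ ++ _.
  move=> f; rewrite /St mem_cat => /orP[|hf]; last first.
    by apply: AffMem; rewrite !mem_cat hf !orbT.
  rewrite !inE => /or4P[]/eqP->.
  - by apply: AffMem; rewrite !mem_cat !inE eqxx !orbT.
  - by apply: AffMem; rewrite !mem_cat !inE eqxx !orbT.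
  - by apply: AffMem; rewrite !mem_cat !inE eqxx !orbT.
  apply: (@aff_ext _ _ _ (acc j \+ (fun t => rl u t / 2 ^+ (j %% S)%N.+1))); last first.
    apply: affD; last apply: aff_mul; apply: AffMem; by rewrite !mem_cat !inE eqxx ?orbT.
  move=> t /=; rewrite /acc big_ord_recr /=; congr (_ + _).
  rewrite mulrA; congr (_ / _).
  rewrite /rl /u.
  have z2 : zp j t + zm j t = `|(l t)%:R - (j %/ S)%N%:R| := max_subr_abs _ _.
  rewrite z2; have [lj|lj] := eqVneq (l t) (j %/ S)%N.
    by rewrite lj subrr normr0 subr0 mul1r max_r.
  have := natr_dist_ge1 R lj.
  by rewrite mul0r => h; rewrite max_l //; case: (b t j) => /=; lra.
apply: net_comp St0 _.
apply: net_out (net_loop StS) => f; rewrite inE => /orP[/eqP->|hf]; last first.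
  by apply: AffMem; rewrite /St !mem_cat hf !orbT.
apply: (@aff_ext _ _ _ (acc L)); last first.
  by apply: AffMem; rewrite /St !mem_cat !inE eqxx !orbT.
move=> t; rewrite /acc /L (sum_block (fun i => (b t i)%:R / 2 ^+ (i %% S)%N.+1) (lM t) S0); apply: eq_bigr => i _.
by rewrite modnMDl modn_small.
Qed.

End Fitting.

(** * Fitting values at integers; products *)

Section PointFitting.
Context {R : realType} {T : Type}.
Implicit Types (f g h y z : T -> R) (F G H Cs : seq (T -> R)) (n m W : nat).

(** An integer never lies strictly between [c A - 1] and [c A], so the digits of an index need no
    exceptional set. *)
Lemma spaced_div (i : T -> nat) A : (0 < A)%N ->
  spaced (fun t => (i t)%:R : R) (fun t => (i t %/ A)%N) A%:R 1.
Proof.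
move=> A0 t c; split; first by rewrite leq_divRL // -natrM ler_nat.
by rewrite ltn_divLR // -natrM lerBrDr -(natrD _ _ 1) ler_nat addn1.
Qed.

Lemma aff_mod H (i : T -> nat) A : aff H (fun t => (i t)%:R) ->
  aff H (fun t => (i t %/ A)%N%:R) -> aff H (fun t => (i t %% A)%N%:R : R).
Proof.
move=> hi hd; apply: (aff_ext _ (affB hi (aff_mul A%:R hd))) => t /=.
by rewrite {1}(divn_eq (i t) A) natrD natrM addrAC subrr add0r.
Qed.

Lemma net_plane W N M E S H (i : T -> nat) (b : nat -> nat -> bool) :
  (0 < N)%N -> (0 < M)%N -> (0 < S)%N -> (M <= 2 ^ E)%N -> (3 * N + 6 <= W)%N ->
  (forall t, (i t < N * (N * (M * M)))%N) -> aff H (fun t => (i t)%:R) ->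
  net (1 + (1 + (E + ((1 + M) + (1 + M * S * 2))))) W H
    [:: fun t => binval (b (i t)) S : R].
Proof.
move=> N0 M0 S0 ME hW iN hi.
pose A1 := (N * (M * M))%N; pose A2 := (M * M)%N.
have A10 : (0 < A1)%N by rewrite !muln_gt0 N0 M0.
have A20 : (0 < A2)%N by rewrite !muln_gt0 M0.
pose y1 t := (i t %% A1)%N; pose y2 t := (y1 t %% A2)%N.
pose p t := (i t %/ A1)%N; pose q t := (y1 t %/ A2)%N.
pose l1 t := (y2 t %/ M)%N; pose l2 t := (y2 t %% M)%N.
have pN t : (p t < N)%N by rewrite ltn_divLR.
have y1A t : (y1 t < A1)%N by rewrite ltn_mod.
have y2A t : (y2 t < A2)%N by rewrite ltn_mod.
have qN t : (q t < N)%N by rewrite ltn_divLR.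
have l1M t : (l1 t < M)%N by rewrite ltn_divLR.
have l2M t : (l2 t < M)%N by rewrite ltn_mod.
pose nf (k : T -> nat) : T -> R := fun t => (k t)%:R.
have nf0 k t : 0 <= nf k t by [].
have mem0 (k : T -> nat) (F : seq (T -> R)) : aff ((fun t => 0 + (k t)%:R) :: F) (nf k).
  by apply: (aff_ext _ (AffMem (mem_head _ _))) => t; rewrite add0r.
have quant1 (k : T -> nat) A H' Cs : (0 < A)%N -> (size Cs <= 2)%N ->
    (forall t, (k t %/ A < N)%N) -> aff H' (nf k) ->
    (forall h, h \in Cs -> aff H' h) -> (forall h, h \in Cs -> forall t, 0 <= h t) ->
    net 1 W H' ((fun t => 0 + (k t %/ A)%N%:R) :: Cs).
  move=> A0 sC kA hk hC C0.
  apply: (@net_quant _ _ W Cs 1 A%:R [:: N] H' (nf k) (fun=> 0)) => //.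
  - by move=> a; rewrite inE => /eqP->; lia.
  - by move=> t; rewrite big_seq1.
  - exact: spaced_div.
  - exact: AffCst.
apply: (@net_comp _ _ _ _ _ _ ((fun t => 0 + (p t)%:R) :: [:: nf i])).
  apply: quant1 => // h; by rewrite inE => /eqP->.
apply: (@net_comp _ _ _ _ _ _ ((fun t => 0 + (q t)%:R) :: [:: nf p; nf y1])).
  have hy : aff [:: fun t => 0 + (p t)%:R; nf i] (nf y1).
    by apply: aff_mod; [apply: AffMem; rewrite !inE eqxx orbT|exact: mem0].
  by apply: quant1 => // h; rewrite !inE => /orP[]/eqP->.
apply: (@net_comp _ _ _ _ _ _ ((fun t => 0 + (l1 t)%:R) :: [:: nf p; nf q; nf y2])).
  set H' := _ :: _.
  have hq : aff H' (nf q) by exact: mem0.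
  have hy : aff H' (nf y2).
    by apply: aff_mod hq; apply: AffMem; rewrite !inE eqxx !orbT.
  (* As [M <= 2 ^ E], [l1] is read as [E] binary digits, one layer each: a single digit in base [M]
     would make the width depend on [M]. *)
  rewrite -[X in net X](size_nseq E 2%N).
  apply: (@net_quant _ _ W _ 1 M%:R _ H' (nf y2) (fun=> 0)) => //.
  - by move=> a; rewrite mem_nseq => /andP[_ /eqP->] /=; lia.
  - by move=> t; rewrite (leq_trans (l1M t)) // big_nseq iter_muln_1.
  - exact: (spaced_div y2 M0).
  - exact: AffCst.
  - move=> h; rewrite !inE => /or3P[]/eqP-> //.
    by apply: AffMem; rewrite !inE eqxx !orbT.
  - by move=> h; rewrite !inE => /or3P[]/eqP->.
set H' := _ :: _.
have hl1 : aff H' (nf l1) by exact: mem0.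
have hl2 : aff H' (nf l2).
  by apply: aff_mod hl1; apply: AffMem; rewrite !inE eqxx !orbT.
(* The real number selected by [(c1, c2, c3)] lists [S] bits for each [c4]. *)
pose idx c1 c2 c3 c4 := (c1 * A1 + (c2 * A2 + (c3 * M + c4)))%N.
have idxE t : idx (p t) (q t) (l1 t) (l2 t) = i t.
  by rewrite /idx -!divn_eq.
pose bb t j := b (idx (p t) (q t) (l1 t) (j %/ S)%N) (j %% S)%N.
pose a c1 c2 c3 : R := binval (fun j => b (idx c1 c2 c3 (j %/ S)%N) (j %% S)%N) (M * S).
apply: (@net_comp _ _ _ _ _ _ ((fun t => a (p t) (q t) (l1 t)) :: [:: nf l2])).
  apply: (@net_fit _ _ W N M) => //.
  - by rewrite /=; lia.
  - move=> c1 c2 c3; have /andP[-> h] := binval_bound (R := R)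
      (fun j => b (idx c1 c2 c3 (j %/ S)%N) (j %% S)%N) (M * S).
    by rewrite (le_trans h) // gerBl invr_ge0 exprn_ge0.
  - by apply: AffMem; rewrite !inE eqxx !orbT.
  - by apply: AffMem; rewrite !inE eqxx !orbT.
  - by move=> h; rewrite inE => /eqP->.
  - by move=> h; rewrite inE => /eqP->.
apply: (@net_out _ _ _ _ _ [:: fun t => binval (fun j => bb t (l2 t * S + j)%N) S : R]).
  move=> f; rewrite inE => /eqP->; apply: (aff_ext _ (AffMem (mem_head _ _))) => t.
  apply: eq_bigr => j _.
  by rewrite /bb divnMDl // divn_small // addn0 idxE modnMDl modn_small.
apply: (@net_extract _ _ W M S) => //.
- by rewrite /=; lia.
- by apply: AffMem; rewrite mem_head.
- by apply: AffMem; rewrite !inE eqxx !orbT.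
Qed.

Lemma net_points N M E S P H (i : T -> nat) (u : nat -> R) :
  (0 < N)%N -> (0 < M)%N -> (0 < S)%N -> (M <= 2 ^ E)%N ->
  (forall t, (i t < N * (N * (M * M)))%N) -> aff H (fun t => (i t)%:R) ->
  (forall c, 0 <= u c <= 1) ->
  exists v, net (E + M + 4 + 2 * M * S) (P * (3 * N + 6)) H [:: v] /\
    forall t, 0 <= v t <= 1 /\ `|u (i t) - v t| <= (2 ^+ (P * S))^-1.
Proof.
move=> N0 M0 S0 ME iN hi u01.
have /choice[b hb] : forall c, exists b, `|u c - binval b (P * S)| <= (2 ^+ (P * S))^-1.
  by move=> c; exact: binary_expansion.
pose v pl t : R := binval (fun j => b (i t) (pl * S + j)%N) S.
exists (fun t => binval (b (i t)) (P * S)); split; last first.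
  move=> t; split=> //.
  have /andP[-> h] := binval_bound (R := R) (b (i t)) (P * S).
  by rewrite (le_trans h) // gerBl invr_ge0 exprn_ge0.
apply: (@net_out _ _ _ _ _ (flatten [seq [:: v pl] | pl <- iota 0 P])).
  move=> f; rewrite inE => /eqP->.
  apply: (@aff_ext _ _ _ (fun t => \sum_(pl <- iota 0 P) (v pl t / 2 ^+ (pl * S)))).
    by move=> t; rewrite binval_blocks -[RHS](big_mkord xpredT (fun pl => v pl t / 2 ^+ (pl * S)))
      /index_iota subn0.
  apply: (aff_sum_in (f := fun pl t => v pl t / 2 ^+ (pl * S))) => pl hpl.
  apply/aff_mul/AffMem/flattenP; exists [:: v pl]; last exact: mem_head.
  exact: map_f.
have {1}-> : P = size (iota 0 P) by rewrite size_iota.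
have -> : (E + M + 4 + 2 * M * S = 1 + (1 + (E + ((1 + M) + (1 + M * S * 2)))))%N.
  by rewrite -mulnA mulnC; lia.
apply: net_bigcat => pl _.
exact: (@net_plane _ N M E S H i (fun c j => b c (pl * S + j)%N)).
Qed.

End PointFitting.

Section Products.
Context {R : realType} {T : Type}.
Implicit Types (f g h y z u v w x : T -> R) (F G H Cs hs : seq (T -> R)) (n m W : nat).

(** The slopes on successive unit intervals are 1, 3, 5, ... for [eps = 1] and 1, -1, 1, ... for
    [eps = -1]. Both sums use the same hinges, so one layer yields the interpolated square and the
    triangle wave. *)
Definition saw_sum (eps : R) n (y : R) : R :=
  \sum_(c < n) (eps ^+ c * (if c == 0%N :> nat then 1 else 2)) * Num.max 0 (y - c%:R).

Lemma saw_sum_recr eps n (y : R) : saw_sum eps n.+1 y = saw_sum eps n y +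
  (eps ^+ n * (if n == 0%N then 1 else 2)) * Num.max 0 (y - n%:R).
Proof. exact: big_ord_recr. Qed.

Lemma saw_sum1 n (y : R) : n%:R <= y ->
  saw_sum 1 n.+1 y = (2 * n%:R + 1) * y - n%:R * (n%:R + 1).
Proof.
elim: n => [|n IH] ny.
  by rewrite saw_sum_recr /saw_sum big_ord0 /= subr0 max_r // expr0; ring.
rewrite saw_sum_recr max_r ?subr_ge0 // IH /=; last first.
  by rewrite (le_trans _ ny) // ler_nat.
by rewrite expr1n -natr1; ring.
Qed.

Lemma saw_sumN1 n (y : R) : n%:R <= y ->
  saw_sum (-1) n.+1 y = if odd n then n%:R + 1 - y else y - n%:R.
Proof.
elim: n => [|n IH] ny.
  by rewrite saw_sum_recr /saw_sum big_ord0 /= subr0 max_r // expr0; ring.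
rewrite saw_sum_recr max_r ?subr_ge0 // IH /=; last first.
  by rewrite (le_trans _ ny) // ler_nat.
by rewrite -signr_odd /=; case: (odd n); rewrite /= ?expr1 ?expr0 -natr1; ring.
Qed.

(* [saw_sum 1] interpolates [y ^+ 2] linearly at the integers; the defect is
   again of the form [z - z ^+ 2], with [z] the triangle wave. *)
Lemma saw_sum_square n (y : R) : 0 <= y <= n.+1%:R ->
  0 <= saw_sum (-1) n.+1 y <= 1 /\
  saw_sum 1 n.+1 y =
    y ^+ 2 + (saw_sum (-1) n.+1 y - saw_sum (-1) n.+1 y ^+ 2).
Proof.
elim: n => [|n IH] /andP[y0 yn].
  by rewrite (@saw_sum1 0) // (@saw_sumN1 0) //=; split; [lra|ring].
have [yn1|yn1] := leP y n.+1%:R.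
  have z : Num.max 0 (y - n.+1%:R) = 0 :> R by rewrite max_l // subr_le0.
  by rewrite ![saw_sum _ n.+2 _]saw_sum_recr z !mulr0 !addr0; apply: IH; rewrite y0.
have {}yn1 := ltW yn1.
rewrite (saw_sum1 yn1) (saw_sumN1 yn1); move: yn yn1; rewrite -[n.+2%:R]natr1.
by move: n.+1%:R => k h1 h2; case: (odd _); split; (try lra); ring.
Qed.

(** The target [w - rho * (tau - tau ^+ 2)] is invariant: a layer replaces [tau] by the triangle
    wave of [n.+1 * tau], divides [rho] by [n.+1 ^+ 2] and adjusts [w]. What is dropped at the end
    is at most a quarter of the last [rho]. Starting from [w = tau] and [rho = 1], the target is
    [tau ^+ 2]. *)
Lemma net_square n m H (tau w : T -> R) (rho : R) :
  0 <= rho -> aff H tau -> aff H w -> (forall t, 0 <= tau t <= 1) ->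
  (forall t, 0 <= w t - rho * (tau t - tau t ^+ 2)) ->
  exists w', net m (n + 2) H [:: w'] /\
    forall t, 0 <= w' t - (w t - rho * (tau t - tau t ^+ 2))
      <= rho * (n.+1%:R ^- 2) ^+ m / 4.
Proof.
elim: m H tau w rho => [|m IH] H tau w rho r0 ht hw t01 x0.
  exists w; split; first by move=> f; rewrite inE => /eqP->.
  move=> t; have := t01 t; rewrite expr0 opprB addrC subrK mulr1.
  move: (tau t) => s s01; apply/andP; split.
    by rewrite mulr_ge0 // -[s ^+ 2]mulr1 expr2; nra.
  have : 0 <= rho * (s - 1/2) ^+ 2 by rewrite mulr_ge0 // sqr_ge0.
  by rewrite expr2; nra.
set N : R := n.+1%:R; have N0 : 0 < N by rewrite ltr0n.
pose B t := saw_sum (-1) n.+1 (N * tau t).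
pose A t := saw_sum 1 n.+1 (N * tau t).
have Nt t : 0 <= N * tau t <= n.+1%:R.
  by have /andP[h0 h1] := t01 t; rewrite mulr_ge0 ?(ltW N0) // -[X in _ <= X]mulr1 ler_pM2l.
pose w1 t := w t - rho * (tau t - A t / N ^+ 2).
pose x t := w t - rho * (tau t - tau t ^+ 2).
have xE t : w1 t - rho * N ^- 2 * (B t - B t ^+ 2) = x t.
  have [_ E] := saw_sum_square (Nt t).
  rewrite /w1 /x /A E -/(B t); field; exact: lt0r_neq0.
have B01 t : 0 <= B t <= 1 by have [] := saw_sum_square (Nt t).
have r1 : 0 <= rho * N ^- 2 by rewrite mulr_ge0 // invr_ge0 exprn_ge0 // ltW.
(* [w] has to be nonnegative to be carried; it is, because it is at least the target. *)
have w0 t : 0 <= w t.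
  have := x0 t; have := t01 t; have : 0 <= rho * (tau t * (1 - tau t)).
    by have := t01 t => /andP[h0 h1]; rewrite !mulr_ge0 // subr_ge0.
  by rewrite expr2; lra.
have [w' [hn hw']] := IH [:: B; w1] B w1 (rho * N ^- 2) r1
   (AffMem (mem_head _ _)) (AffMem (mem_last B [:: w1])) B01
   (fun t => ltac:(rewrite xE; exact: x0)).
exists w'; split; last first.
  by move=> t; have := hw' t; rewrite xE [_ ^+ m.+1]exprS (mulrA rho).
apply: (@net_comp _ _ 1 m _ _ [:: B; w1]) => //.
apply: (@net1c _ _ _ _ [seq (fun t => N * tau t - c%:R) | c <- iota 0 n.+1] [:: w]).
- by rewrite size_map size_iota /=; lia.
- by move=> g /mapP[c _ ->]; apply: affB; [apply: AffScale|apply: AffCst].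
- by move=> g; rewrite inE => /eqP->.
- by move=> g; rewrite inE => /eqP->.
set H' := _ ++ _.
have hats c : (c < n.+1)%N -> aff H' (rl (fun t => N * tau t - c%:R)).
  move=> cn; apply: AffMem; rewrite mem_cat; apply/orP; left.
  by apply/map_f/mapP; exists c; rewrite // mem_iota.
have saws eps : aff H' (fun t => saw_sum eps n.+1 (N * tau t)).
  by apply: aff_sum => c; apply: AffScale; apply: hats.
move=> f; rewrite !inE => /orP[]/eqP->; first exact: saws.
apply: affB; first by apply: AffMem; rewrite mem_cat !inE eqxx orbT.
apply: AffScale; apply: affB; last exact/aff_mul/saws.
(* The hinge at 0 gives back [tau], which needs no neuron of its own. *)
apply: (@aff_ext _ _ _ (fun t => rl (fun t => N * tau t - 0%:R) t / N)).
  move=> t; rewrite /rl subr0 max_r; last by have /andP[] := Nt t.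
  by rewrite mulrC mulKf // lt0r_neq0.
exact/aff_mul/hats.
Qed.

(** Three squares are computed in parallel. The last of the [m.+1] layers clamps their combination,
    so that the result can be a factor again. *)
Lemma net_prod n m H u v Cs : aff H u -> aff H v ->
  (forall t, 0 <= u t <= 1) -> (forall t, 0 <= v t <= 1) ->
  (forall h, h \in Cs -> aff H h) -> (forall h, h \in Cs -> forall t, 0 <= h t) ->
  exists w, net m.+1 (3 * (n + 2) + size Cs) H (w :: Cs) /\
    forall t, 0 <= w t <= 1 /\ `|w t - u t * v t| <= (n.+1%:R ^- 2) ^+ m / 2.
Proof.
move=> hu hv u01 v01 hC C0; set e := (n.+1%:R ^- 2) ^+ m.
have sq x : aff H x -> (forall t, 0 <= x t <= 1) ->
    exists w, net m (n + 2) H [:: w] /\ forall t, 0 <= w t - x t ^+ 2 <= e / 4.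
  move=> hx x01; have [||w [hw E]] := @net_square n m H x x 1 _ hx hx x01.
  - by [].
  - by move=> t; rewrite mul1r opprB subrKC sqr_ge0.
  exists w; split=> // t; have := E t.
  by rewrite !mul1r -/e; lra.
have [s1 [n1 E1]] := sq u hu u01; have [s2 [n2 E2]] := sq v hv v01.
have [||s3 [n3 E3]] := sq (fun t => (u t + v t) / 2).
- exact/aff_mul/AffAdd.
- by move=> t; have := u01 t; have := v01 t; lra.
(* [u v = 2 ((u + v) / 2)^2 - u^2 / 2 - v^2 / 2], clamped to [0, 1]. *)
pose z t := 2 * s3 t - s1 t / 2 - s2 t / 2.
exists (rl z \- rl (fun t => z t - 1)); split; last first.
  move=> t; have uv0 : 0 <= u t * v t.
    by apply: mulr_ge0; have := u01 t; have := v01 t; lra.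
  have uv1 : u t * v t <= 1.
    by apply: mulr_ile1; have := u01 t; have := v01 t; lra.
  (* Each square errs upwards by at most [e / 4], so the error of [z] lies between [- e / 4] and
     [e / 2]. *)
  have ze : `|z t - u t * v t| <= e / 2.
    have := E1 t; have := E2 t; have := E3 t; rewrite /z !expr2 ler_norml.
    by move: (u t) (v t) (s1 t) (s2 t) (s3 t) => a b c d f; lra.
  move: ze; rewrite /= /rl !ler_norml; case: (leP 0 (z t)); case: (leP 0 (z t - 1)); lra.
rewrite -addn1; apply: (@net_comp _ _ _ _ _ _ ([:: s3] ++ [:: s1] ++ [:: s2] ++ Cs)).
  have -> : (3 * (n + 2) + size Cs = (n + 2) + ((n + 2) + ((n + 2) + size Cs)))%N by lia.
  by apply: net_cat => //; apply: net_cat => //; apply: net_cat => //; apply: net_carry.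
set H' := _ ++ _.
have hz : aff H' z.
  apply: affB; [apply: affB|]; [apply: AffScale|apply: aff_mul|apply: aff_mul];
    by apply: AffMem; rewrite !mem_cat !inE eqxx ?orbT.
apply: (@net1c _ _ _ _ [:: z; fun t => z t - 1] Cs).
- by rewrite /=; lia.
- by move=> g; rewrite !inE => /orP[]/eqP->//; apply: affB => //; apply: AffCst.
- by move=> g hg; apply: AffMem; rewrite !mem_cat hg !orbT.
- exact: C0.
move=> f; rewrite inE => /orP[/eqP->|hf].
  by apply: affB; apply: AffMem; rewrite mem_cat /= !inE eqxx ?orbT.
by apply: AffMem; rewrite mem_cat hf orbT.
Qed.

(** All factors lie in [0, 1], so the errors of successive products add up without being
    amplified. *)
Lemma net_prods n m Cs hs H u : aff H u -> (forall t, 0 <= u t <= 1) ->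
  (forall h, h \in Cs -> aff H h) -> (forall h, h \in Cs -> forall t, 0 <= h t) ->
  (forall h, h \in hs -> aff Cs h) -> (forall h, h \in hs -> forall t, 0 <= h t <= 1) ->
  exists w, net (size hs * m.+1) (3 * (n + 2) + size Cs) H [:: w] /\
    forall t, `|w t - u t * \prod_(h <- hs) h t| <=
      (size hs)%:R * ((n.+1%:R ^- 2) ^+ m / 2).
Proof.
move=> + + + C0; elim: hs H u => [|h hs IH] H u hu u01 hC hhs h01.
  exists u; split; first by move=> f; rewrite inE => /eqP->.
  by move=> t; rewrite big_nil mulr1 subrr normr0 mul0r.
have hh : h \in h :: hs by exact: mem_head.
have [w1 [n1 E1]] := @net_prod n m H u h Cs hu (aff_comp hC (hhs h hh)) u01 (h01 h hh) hC C0.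
have [|||||w [n2 E2]] := IH (w1 :: Cs) w1.
- exact/AffMem/mem_head.
- by move=> t; case: (E1 t).
- by move=> g hg; apply: AffMem; rewrite inE hg orbT.
- by move=> g hg; apply: hhs; rewrite inE hg orbT.
- by move=> g hg; apply: h01; rewrite inE hg orbT.
exists w; split; first by apply: net_comp n1 n2.
move=> t; rewrite big_cons /= -natr1 mulrDl mul1r mulrA.
set Q := \prod_(_ <- _) _; rewrite -[w t](subrK (w1 t * Q)) -addrA -mulrBl.
apply: le_trans (ler_normD _ _) _; apply: lerD; first exact: E2.
have Q01 : 0 <= Q <= 1.
  rewrite /Q big_seq; apply/andP; split.
    by apply: prodr_ge0 => g hg; have /andP[] := h01 g (mem_behead (s := h :: hs) hg) t.
  by apply: prodr_ile1 => g hg; apply: h01; rewrite inE hg orbT.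
rewrite normrM; have [_ E] := E1 t; apply: le_trans E.
by case/andP: Q01 => Q0 Q1; rewrite (ger0_norm Q0) ler_piMr.
Qed.

End Products.

(** * Taylor expansion *)

Section Taylor1d.
Context {R : realType}.
Implicit Types (G : nat -> R -> R) (a : nat -> R) (n k : nat) (t h C : R).

Definition tpoly a n : {poly R} := \poly_(k < n.+1) (a k / k`!%:R).

Lemma deriv_tpoly a n : (tpoly a n.+1)^`() = tpoly (a \o S) n.
Proof.
apply/polyP => k; rewrite coef_deriv !coef_poly ltnS; case: ifP => // _; last by rewrite mul0rn.
rewrite -[_ *+ k.+1]mulr_natr -mulrA; congr (_ * _); rewrite factS natrM invfM mulrAC mulVf ?mul1r //.
Qed.

Lemma horner_tpoly a n t : (tpoly a n).[t] = \sum_(k < n.+1) t ^+ k / k`!%:R * a k.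
Proof. by rewrite horner_poly; apply: eq_bigr => k _; rewrite mulrC mulrA mulrAC. Qed.

(** By induction the derivative of the error is bounded by the derivative of [q], and the mean value
    theorem applied to [q] plus or minus the error concludes. The number [a n] need not be [G n 0]:
    the top derivative will be compared with its value at another point. *)
Lemma taylor_bound n G a h C :
  (forall k t, (k < n)%N -> t \in `]0, h[ -> is_derive t 1 (G k) (G k.+1 t)) ->
  (forall k, (k < n)%N -> {within `[0, h], continuous (G k)}) ->
  (forall k, (k < n)%N -> G k 0 = a k) ->
  (forall t, 0 <= t <= h -> `|G n t - a n| <= C) ->
  forall t, 0 <= t <= h -> `|G 0%N t - (tpoly a n).[t]| <= C * t ^+ n / n`!%:R.
Proof.
elim: n G a => [|n IH] G a hd hc h0 hn t t01.
  rewrite horner_tpoly big_ord1 /= !expr0 !fact0 !divr1 mul1r mulr1; exact: hn.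
have {}IH := IH (G \o S) (a \o S) (fun k => hd k.+1) (fun k => hc k.+1)
  (fun k => h0 k.+1) hn.
have /andP[t0 th] := t01; move: t0; rewrite le_eqVlt => /orP[/eqP <-|t0].
  rewrite h0 // horner_tpoly big_ord_recl expr0 fact0 divr1 mul1r big1.
    by rewrite addr0 subrr normr0 exprS mul0r mulr0 mul0r.
  by move=> i _; rewrite exprS !mul0r.
have [q [qE dqE]] : exists q : {poly R}, (forall u, q.[u] = C * u ^+ n.+1 / n.+1`!%:R) /\
    (forall u, q^`().[u] = C * u ^+ n / n`!%:R).
  exists ((C / n.+1`!%:R) *: 'X^(n.+1)); split=> u.
    by rewrite hornerZ hornerXn mulrAC.
  rewrite derivZ derivXn hornerZ hornerMn hornerXn -[_ *+ n.+1]mulr_natr factS natrM.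
  by field; rewrite -(natrD _ 1 n) !pnatr_eq0 -lt0n fact_gt0.
have key (eps : R) : `|eps| = 1 -> eps * (G 0%N t - (tpoly a n.+1).[t]) <= q.[t].
  move=> e1; pose p := q + eps *: tpoly a n.+1.
  pose f : R -> R := horner p - eps \*: G 0%N.
  pose df u := p^`().[u] - eps *: G 1%N u.
  have f0 : f 0 = 0.
    rewrite /f /p !fctE hornerD hornerZ qE exprS mul0r mulr0 mul0r add0r horner_tpoly.
    rewrite big_ord_recl /= expr0 fact0 divr1 mul1r big1; last first.
      by move=> i _; rewrite exprS !mul0r.
    by rewrite addr0 -h0 // subrr.
  have fd u : u \in `]0, t[ -> is_derive u 1 f (df u).
    move=> /andP[u0 ut]; apply: (is_deriveB (is_derive_poly p u)).
    apply: is_deriveZ; apply: hd => //; rewrite in_itv /=; apply/andP; split=> //.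
    exact: lt_le_trans ut th.
  have fc : {within `[0, t], continuous f}.
    apply: within_continuousB.
      by apply: derivable_within_continuous => u _; have [] := is_derive_poly p u.
    have sub : `[0, t]%classic `<=` `[0, h]%classic.
      by apply: subset_itvl; rewrite bnd_simp.
    have := continuous_subspaceW sub (hc 0%N isT).
    by move=> cG u; apply: cvgZr; exact: cG.
  have [u ut] := MVT t0 fd fc.
  rewrite f0 !subr0 => E; suff : 0 <= f t.
    rewrite /f /p !fctE hornerD hornerZ mulrBr.
    by change ((eps \*: G 0%N) t) with (eps * G 0%N t); lra.
  rewrite E; apply: mulr_ge0; last exact: ltW.
  have /andP[u0 ut'] : 0 < u < t by move: ut; rewrite in_itv.
  rewrite /df /p derivD derivZ deriv_tpoly hornerD hornerZ dqE.
  have := IH u; rewrite (ltW u0) (ltW (lt_le_trans ut' th)) => /(_ isT) /=.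
  rewrite -[X in X <= _]mul1r -{1}e1 -normrM => /(le_trans (ler_norm _)).
  rewrite mulrBr => le1.
  by change (eps *: G 1%N u) with (eps * G 1%N u); lra.
rewrite -qE ler_norml; have := key 1 (normr1 _); have := key (-1).
by rewrite normrN normr1 mulN1r mul1r => /(_ erefl); lra.
Qed.

End Taylor1d.

Section Partial.
Context {R : realType} {d : nat}.
Implicit Types (g : 'cV[R]_d -> R) (y : 'cV[R]_d) (i : 'I_d).

Notation e_ i := (delta_mx i 0 : 'cV[R]_d).

(** Inside the segment small increments of both signs stay in the cube, so the partial derivative is
    an ordinary one. At the ends it may be one-sided, and only continuity is claimed there. *)
Lemma partial_segment i g y (h : R) : has_partial i g ->
  (forall t, 0 <= t <= h -> cube d (y + t *: e_ i)) ->
  (forall t, t \in `]0, h[ -> is_derive t 1 (fun t => g (y + t *: e_ i))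
     (partial i g (y + t *: e_ i))) /\
  {within `[0, h], continuous (fun t => g (y + t *: e_ i))}.
Proof.
move=> hg hy; pose G t := g (y + t *: e_ i).
have quot t u : dquot i g (y + t *: e_ i) u = (G (t + u) - G t) / u.
  by rewrite /dquot /G -addrA -scalerDl.
have cubeE t u : cube d (y + t *: e_ i + u *: e_ i) = cube d (y + (t + u) *: e_ i).
  by rewrite -addrA -scalerDl.
split=> [t ht|].
  have /andP[t0 th] : 0 < t < h by move: ht; rewrite in_itv.
  have cv := hg _ (hy t (ltac:(by rewrite !ltW))).
  have inc : increments i (y + t *: e_ i) = 0^'.
    rewrite /increments; apply/seteqP; split=> A; last first.
      by apply: filterS => u Au _.
    suff D : 0^' [set u | cube d (y + t *: e_ i + u *: e_ i)].
      move=> WA; exact: (filterS2 _ (fun u (h1 : _ -> A u) h2 => h1 h2) WA D).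
    apply: nbhs_dnbhs.
    have e0 : 0 < Num.min t (h - t) by rewrite lt_min t0 subr_gt0.
    exists (Num.min t (h - t)) => // u /=; rewrite sub0r normrN lt_min !ltr_norml.
    by move=> u1; rewrite cubeE; apply: hy; lra.
  have dq : dquot i g (y + t *: e_ i) =
      (fun u => u^-1 *: (((fun t => g (y + t *: e_ i)) \o shift t) (u *: 1) -
                          g (y + t *: e_ i))).
    apply/funext => u; rewrite quot /= mulrC /shift /= [u *: 1]mulr1 addrC.
    by rewrite /G [u + t]addrC addrC.
  rewrite inc dq in cv.
  by apply: DeriveDef => //; rewrite /derive /partial inc dq.
apply/subspace_continuousP => x /=; rewrite in_itv /= => x0h.
apply/cvgrPdist_le => eps eps0.
have := hg _ (hy x x0h); move: (lim _) => L /cvgrPdist_le /(_ 1 ltr01).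
rewrite /increments !near_withinE => near1.
have [delta d0 Hd] := near1.
(* Near [x] the difference quotient is within 1 of its limit [L], hence bounded by [K]; this
   Lipschitz bound at [x] gives continuity, at the ends too. *)
pose K := `|L| + 1; have K0 : 0 < K by rewrite ltr_wpDl.
exists (Num.min delta (eps / K)).
  by rewrite /= lt_min d0 divr_gt0.
move=> t /=; rewrite lt_min => /andP[xt1 xt2]; rewrite in_itv /= => t0h; rewrite -/(G x) -/(G t).
have [->|xt] := eqVneq t x; first by rewrite subrr normr0 ltW.
have u0 : t - x != 0 by rewrite subr_eq0.
have := Hd (t - x); rewrite /= sub0r opprB xt1 => /(_ isT u0).
rewrite cubeE quot subrKC => /(_ (hy t t0h)) le1.
rewrite distrC; have -> : G t - G x = (G t - G x) / (t - x) * (t - x) by rewrite mulfVK.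
rewrite normrM.
have leK : `|(G t - G x) / (t - x)| <= K.
  by have := ler_normB L (L - (G t - G x) / (t - x)); rewrite subKr /K; lra.
apply: le_trans (ler_wpM2r (normr_ge0 _) leK) _.
by rewrite mulrC -ler_pdivlMr // distrC ltW.
Qed.

End Partial.

Section TaylorTerms.
Context {R : realType} {I : eqType}.
Implicit Types (cs l : seq I) (n k : nat).

(** The pairs [(1 / alpha!, mseq alpha)] for [|alpha| <= n], when [cs] lists the
    coordinates in decreasing order. *)
Fixpoint taylor_terms cs n : seq (R * seq I) :=
  if cs is i :: cs' then
    flatten [seq [seq (wl.1 / k`!%:R, wl.2 ++ nseq k i) | wl <- taylor_terms cs' (n - k)]
            | k <- iota 0 n.+1]
  else [:: (1, [::])].

Lemma taylor_terms0 cs : taylor_terms cs 0 = [:: (1, [::])].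
Proof. by elim: cs => [//|i cs IH] /=; rewrite IH /= fact0 divr1. Qed.

Lemma taylor_termsP cs n wl : wl \in taylor_terms cs n ->
  0 <= wl.1 <= 1 /\ (size wl.2 <= n)%N.
Proof.
elim: cs n wl => [|i cs IH] n wl.
  by rewrite inE => /eqP ->; split=> //=; rewrite ler01 lexx.
move=> /flattenP[_ /mapP[k kn ->] /mapP[wl' wl'in ->]] /=.
have {IH} [/andP[w0 w1] sz] := IH _ _ wl'in.
move: kn; rewrite mem_iota add0n ltnS => /andP[_ kn]; split.
  have k0 : (0 : R) < k`!%:R by rewrite ltr0n fact_gt0.
  rewrite mulr_ge0 ?invr_ge0 ?(ltW k0) // ler_pdivrMr // mul1r (le_trans w1) //.
  by rewrite ler1n fact_gt0.
by rewrite size_cat size_nseq -(subnK kn) leq_add2r.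
Qed.

Lemma leq_sum_expn (m n : nat) : (\sum_(k < n.+1) m ^ (n - k) <= m.+1 ^ n)%N.
Proof.
elim: n => [|n IH]; first by rewrite big_ord1.
rewrite big_ord_recl subn0 [leqRHS]expnS mulSn addnC; apply: leq_add.
  by apply: leq_trans IH; apply/eq_leq/eq_bigr.
rewrite expnS leq_mul //; case: (posnP n) => [-> //|n0].
by rewrite leq_exp2r.
Qed.

(** This count contributes one factor [s + 1] and the factor [d ^ s] both to the width and to the
    error of the network. *)
Lemma size_taylor_terms i cs n :
  (size (taylor_terms (i :: cs) n) <= n.+1 * (size cs).+1 ^ n)%N.
Proof.
elim: cs i n => [|j cs IH] i n.
  rewrite exp1n muln1 size_flatten /shape -!map_comp sumnE big_map.
  by rewrite (eq_bigr (fun=> 1%N)) // sum1_size size_iota.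
rewrite [taylor_terms]lock /= -lock size_flatten /shape -!map_comp sumnE big_map.
apply: leq_trans (leq_mul (leqnn _) (leq_sum_expn _ n)).
rewrite big_distrr /= -(big_mkord xpredT (fun k => n.+1 * (size cs).+1 ^ (n - k)))%N.
rewrite /index_iota subn0; apply: leq_sum => k _.
rewrite /= size_map; apply: leq_trans (IH j _) _.
by rewrite leq_mul // ltnS leq_subr.
Qed.

End TaylorTerms.

Section TaylorHolder.
Context {R : realType} {d s : nat} {r B0 : R} {f : 'cV[R]_d -> R}.
Hypotheses (r0 : 0 < r) (hf : holder_class d s r B0 f).
Implicit Types (cs ds l : seq 'I_d) (x y : 'cV[R]_d) (a : 'I_d -> nat).

Definition blocks a ds : seq 'I_d := flatten [seq nseq (a j) j | j <- ds].

(** Giving exponent 0 to the coordinates outside [ds] makes the word literally an [mseq]. The class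
    constrains only such words, and mixed derivatives are never interchanged. *)
Lemma blocks_mseq a cs ds : rev cs ++ ds = enum 'I_d ->
  exists b : multi_index d, mseq b = blocks a ds.
Proof.
move=> E; exists [ffun j => if j \in ds then a j else 0%N].
have U : uniq (rev cs ++ ds) by rewrite E enum_uniq.
rewrite /mseq -E map_cat flatten_cat [X in X ++ _](_ : _ = [::]).
  congr flatten; apply/eq_in_map => j jd; by rewrite ffunE jd.
move: U; rewrite cat_uniq => /and3P[_ /hasPn U _].
elim: (rev cs) U => [//|j c IH] U /=; rewrite IH ?cats0; last first.
  by move=> k kd; have := U k kd; rewrite inE negb_or => /andP[].
rewrite ffunE; case: ifP => // jd.
by have := U j jd; rewrite /= inE eqxx.
Qed.

Lemma norm1_size (b : multi_index d) : norm1 b = size (mseq b).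
Proof.
rewrite size_flatten /shape -map_comp sumnE big_map /norm1 big_enum.
by apply: eq_bigr => i _ /=; rewrite size_nseq.
Qed.

Lemma norm2_le (eta : R) x : 0 <= eta -> (forall i, `|x i 0| <= eta) ->
  norm2 x <= Num.sqrt d%:R * eta.
Proof.
move=> e0 hx; rewrite -[X in _ * X]ger0_norm // -sqrtr_sqr -sqrtrM ?ler0n //.
apply: ler_wsqrtr; rewrite mulrC mulr_natr.
apply: le_trans (_ : \sum_(i < d) eta ^+ 2 <= _); last by rewrite sumr_const card_ord.
by apply: ler_sum => i _; rewrite -real_normK ?num_real // lerXn2r ?nnegrE.
Qed.

Lemma norm2_gt0 x : x != 0 -> 0 < norm2 x.
Proof.
move=> x0; rewrite sqrtr_gt0 lt0r sumr_ge0 ?andbT; last by move=> i _; exact: sqr_ge0.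
apply: contra x0; rewrite psumr_eq0; last by move=> i _; exact: sqr_ge0.
move=> /allP h; apply/eqP/colP => i; rewrite mxE; apply/eqP.
by have := h i (mem_index_enum _); rewrite sqrf_eq0.
Qed.

Lemma holder_le (b : multi_index d) (eta : R) x y : norm1 b = s -> 0 <= B0 ->
  0 <= eta -> cube d x -> cube d y -> (forall i, `|x i 0 - y i 0| <= eta) ->
  `|mpartial b f x - mpartial b f y| <= B0 * (Num.sqrt d%:R * eta) `^ r.
Proof.
move=> bs B00 eta0 cx cy xy; have [->|nxy] := eqVneq x y.
  by rewrite subrr normr0 mulr_ge0 // powR_ge0.
have n0 : 0 < norm2 (x - y) by rewrite norm2_gt0 // subr_eq0.
have [_ _ /(_ b bs x y cx cy nxy)] := hf.
rewrite ler_pdivrMr ?powR_gt0 // => /le_trans -> //.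
rewrite ler_wpM2l // ge0_ler_powR ?nnegrE ?mulr_ge0 ?sqrtr_ge0 ?(ltW n0) ?(ltW r0) //.
by apply: norm2_le => // i; rewrite !mxE.
Qed.

Definition mix cs x0 x : 'cV[R]_d := \col_j (if j \in cs then x j 0 else x0 j 0).

(** The coordinates in [cs] move from [x0] to [x] one after the other, the largest
    first, so that only derivatives of the form [mpartial] occur. *)
Lemma taylor_holder_rec (x0 x : 'cV[R]_d) (eta : R) cs ds l n a :
  0 <= B0 -> cube d x0 -> cube d x ->
  (forall i, 0 <= x i 0 - x0 i 0 <= eta) -> 0 <= eta ->
  rev cs ++ ds = enum 'I_d -> l = blocks a ds -> (size l + n)%N = s ->
  `|partials l f (mix cs x0 x) -
    \sum_(wl <- taylor_terms cs n) wl.1 * (\prod_(j <- wl.2) (x j 0 - x0 j 0))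
       * partials (wl.2 ++ l) f x0|
  <= B0 * (Num.sqrt d%:R * eta) `^ r * ((size cs)%:R * eta) ^+ n / n`!%:R.
Proof.
move=> B00 cx0 cx hx eta0; set C := B0 * _.
have C0 : 0 <= C by rewrite mulr_ge0 // powR_ge0.
pose h j := x j 0 - x0 j 0.
have cmix c : cube d (mix c x0 x).
  by move=> j; rewrite mxE; case: ifP => _; [exact: cx|exact: cx0].
elim: cs ds l n a => [|i cs IH] ds l n a Eds El sl.
  rewrite big_seq1 big_nil !mul1r /=.
  have -> : mix [::] x0 x = x0 by apply/colP => j; rewrite mxE.
  rewrite subrr normr0 mul0r; apply: mulr_ge0; last by rewrite invr_ge0.
  by apply: mulr_ge0; rewrite // exprn_ge0.
have Eds' : rev cs ++ (i :: ds) = enum 'I_d by rewrite -Eds rev_cons cat_rcons.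
have U : uniq (rev cs ++ (i :: ds)) by rewrite Eds' enum_uniq.
have [ics ids] : i \notin cs /\ i \notin ds.
  move: U; rewrite cat_uniq /= negb_or mem_rev.
  by move=> /and3P[_ /andP[-> _] /andP[-> _]].
pose ak k j := if j == i then k else a j.
have Elk k : nseq k i ++ l = blocks (ak k) (i :: ds).
  rewrite El /blocks /= /ak eqxx; congr (_ ++ flatten _); apply/eq_in_map => j jd.
  by case: eqP => // ji; rewrite -ji jd in ids.
pose y := mix cs x0 x.
pose ei : 'cV[R]_d := delta_mx i 0.
have yt t j : (y + t *: ei) j 0 = if j == i then x0 i 0 + t else y j 0.
  rewrite !mxE eqxx andbT; case: eqVneq => [->|_]; last by rewrite mulr0 addr0.
  by rewrite (negbTE ics) mulr1.
have cyt t : 0 <= t <= h i -> cube d (y + t *: ei).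
  move=> ht j; rewrite yt; case: eqP => _; last exact: cmix.
  by have := cx0 i; have := cx i; move: ht; rewrite /h; lra.
pose G k t := partials (nseq k i ++ l) f (y + t *: ei).
have bk k : exists b : multi_index d, mseq b = nseq k i ++ l.
  by rewrite (Elk k); apply: blocks_mseq Eds'.
have seg k : (k < n)%N ->
   (forall t, t \in `]0, h i[ -> is_derive t 1 (G k) (G k.+1 t)) /\
   {within `[0, h i], continuous (G k)}.
  move=> kn; have [b Eb] := bk k.+1.
  have : has_mpartial b f.
    have [+ _ _] := hf; apply; rewrite norm1_size Eb size_cat size_nseq; lia.
  rewrite /has_mpartial Eb => -[_ hp].
  exact: (@partial_segment _ _ i _ y (h i) hp cyt).
(* Below order [n] the coefficients are derivatives at [y], which [IH] expands further around [x0].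
   At order [n] the derivative at [x0] is taken at once, since the Hölder condition bounds its
   change. *)
pose aa k := if (k < n)%N then G k 0 else partials (nseq n i ++ l) f x0.
have hi : 0 <= h i <= h i by have /andP[-> _] := hx i; rewrite lexx.
have T1 := @taylor_bound R n G aa (h i) C (fun k t kn => (seg k kn).1 t)
  (fun k kn => (seg k kn).2) (fun k kn => ltac:(by rewrite /aa kn)) _ (h i) hi.
have {}T1 : `|G 0%N (h i) - (tpoly aa n).[h i]| <= C * h i ^+ n / n`!%:R.
  apply: T1 => t ht; rewrite /aa ltnn /G; have [b Eb] := bk n.
  rewrite -Eb; apply: holder_le => //; first by rewrite norm1_size Eb size_cat size_nseq addnC.
    exact: cyt.
  move=> j; rewrite yt; case: eqP => [->|_].
    by rewrite addrAC subrr add0r ger0_norm; have := hx i; move: ht; rewrite /h; lra.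
  rewrite mxE; case: ifP => _; first by have := hx j; rewrite ler_norml; lra.
  by rewrite subrr normr0.
have mixE : mix (i :: cs) x0 x = y + h i *: ei.
  apply/colP => j; rewrite yt mxE inE; case: eqVneq => [->|_] /=.
    by rewrite /h subrKC.
  by rewrite mxE.
pose Sk k := \sum_(wl <- taylor_terms cs (n - k)) wl.1 * (\prod_(j <- wl.2) h j)
       * partials (wl.2 ++ nseq k i ++ l) f x0.
have -> : \sum_(wl <- taylor_terms (i :: cs) n) wl.1 * (\prod_(j <- wl.2) (x j 0 - x0 j 0))
       * partials (wl.2 ++ l) f x0 = \sum_(k < n.+1) h i ^+ k / k`!%:R * Sk k.
  rewrite -(big_mkord xpredT (fun k => h i ^+ k / k`!%:R * Sk k)) /index_iota subn0.
  rewrite big_flatten big_map; apply: eq_bigr => k _.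
  rewrite big_map mulr_sumr; apply: eq_bigr => wl _ /=.
  rewrite big_cat /= -catA big_nseq -/(h i) iter_mulr_1 /h; ring.
rewrite mixE; change (partials l f (y + h i *: ei)) with (G 0%N (h i)).
rewrite -[G _ _](subrK (tpoly aa n).[h i]) -addrA.
apply: le_trans (ler_normD _ _) _.
have T2 k : (k < n)%N -> `|aa k - Sk k| <= C * ((size cs)%:R * eta) ^+ (n - k) / (n - k)`!%:R.
  move=> kn; rewrite /aa kn /G scale0r addr0.
  by apply: (IH (i :: ds) _ _ (ak k)) => //; rewrite size_cat size_nseq; lia.
have T3 : aa n = Sk n.
  by rewrite /aa ltnn /Sk subnn taylor_terms0 big_seq1 big_nil !mul1r.
have -> : (tpoly aa n).[h i] - \sum_(k < n.+1) h i ^+ k / k`!%:R * Sk k =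
    \sum_(k < n) (h i ^+ k / k`!%:R * aa k - h i ^+ k / k`!%:R * Sk k).
  by rewrite horner_tpoly -sumrB big_ord_recr /= T3 subrr addr0.
have le_sum : `|\sum_(k < n) (h i ^+ k / k`!%:R * aa k - h i ^+ k / k`!%:R * Sk k)| <=
   \sum_(k < n) eta ^+ k / k`!%:R * (C * ((size cs)%:R * eta) ^+ (n - k) / (n - k)`!%:R).
  apply: le_trans (ler_norm_sum _ _ _) _; apply: ler_sum => k _.
  have /andP[h0 he] := hx i.
  rewrite -mulrBr normrM ler_pM // ?T2 //.
  rewrite ger0_norm ?mulr_ge0 ?exprn_ge0 ?invr_ge0 //.
  by rewrite ler_wpM2r ?invr_ge0 // lerXn2r ?nnegrE.
apply: le_trans (lerD T1 le_sum) _.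
apply: le_trans (_ : \sum_(k < n.+1) eta ^+ k / k`!%:R *
    (C * ((size cs)%:R * eta) ^+ (n - k) / (n - k)`!%:R) <= _).
  rewrite [leLHS]addrC big_ord_recr; apply: lerD => //=.
  have /andP[h0 he] := hx i.
  rewrite subnn expr0 fact0 divr1 mulr1 [leRHS]mulrC mulrA.
  rewrite ler_wpM2r ?invr_ge0 // ler_wpM2l // lerXn2r ?nnegrE //.
(* The errors of all orders combine by the binomial theorem into the [n]-th power of
   [(size cs + 1) * eta]. *)
rewrite -[(size (i :: cs))%:R]/((size cs).+1%:R) -natr1 mulrDl mul1r exprDn mulr_sumr mulr_suml.
rewrite le_eqVlt; apply/orP; left; apply/eqP/eq_bigr => k _.
have kn : (k <= n)%N by rewrite -ltnS.
rewrite -[_ *+ 'C(n, k)]mulr_natr -(bin_fact kn) !natrM; field.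
by rewrite !pnatr_eq0 -!lt0n !fact_gt0 bin_gt0 kn.
Qed.

Lemma taylor_holder (x0 x : 'cV[R]_d) (eta : R) :
  0 <= B0 -> cube d x0 -> cube d x ->
  (forall i, 0 <= x i 0 - x0 i 0 <= eta) -> 0 <= eta ->
  `|f x - \sum_(wl <- taylor_terms (rev (enum 'I_d)) s)
      wl.1 * (\prod_(j <- wl.2) (x j 0 - x0 j 0)) * partials wl.2 f x0|
  <= B0 * (Num.sqrt d%:R * eta) `^ r * (d%:R * eta) ^+ s / s`!%:R.
Proof.
move=> B00 cx0 cx hx eta0.
have E : rev (rev (enum 'I_d)) ++ [::] = enum 'I_d by rewrite revK cats0.
have := taylor_holder_rec (n := s) (a := fun=> 0%N) B00 cx0 cx hx eta0 E erefl erefl.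
rewrite size_rev size_enum_ord /=.
have -> : mix (rev (enum 'I_d)) x0 x = x.
  by apply/colP => j; rewrite mxE mem_rev mem_enum.
by under eq_bigr do rewrite cats0.
Qed.

Lemma taylor_terms_partials_le (wl : R * seq 'I_d) x0 : cube d x0 ->
  wl \in taylor_terms (rev (enum 'I_d)) s -> `|partials wl.2 f x0| <= B0.
Proof.
move=> cx0 hwl.
suff [b Eb] : exists b : multi_index d, mseq b = wl.2.
  have [_ + _] := hf; rewrite -Eb; apply=> //.
  by rewrite norm1_size Eb; have [] := taylor_termsP hwl.
suff K cs n : uniq cs -> wl \in taylor_terms cs n -> exists a, wl.2 = blocks a (rev cs).
  have [|a Ea] := K (rev (enum 'I_d)) s _ hwl; first by rewrite rev_uniq enum_uniq.
  by rewrite Ea revK; apply: (@blocks_mseq a [::]).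
elim: cs n wl {hwl} => [|i cs IH] n [w l].
  by rewrite inE => _ /eqP[_ ->]; exists (fun=> 0%N).
rewrite cons_uniq => /andP[ics ucs].
move=> /flattenP[_ /mapP[k kn ->] /mapP[wl' wl'in [_ ->]]] /=.
have [a Ea] := IH _ _ ucs wl'in.
exists (fun j => if j == i then k else a j).
rewrite rev_cons /blocks map_rcons -cats1 flatten_cat /= eqxx cats0 Ea; congr (_ ++ _).
congr flatten; apply/eq_in_map => j; rewrite mem_rev => jc.
by case: eqP => // ji; rewrite -ji jc in ics.
Qed.

End TaylorHolder.

(** * The Taylor network *)

Section TaylorNet.
Context {R : realType} {T : Type}.
Implicit Types (f g h y z : T -> R) (F G H Cs : seq (T -> R)) (n m W : nat).

(** When [M <= 2 ^ E], two digits in base [N] and [2 * E] bits cover the [(M N)^2] cells that a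
    single axis may have if [d = 1]. Reading the factor [M ^ 2] bit by bit costs depth of order
    [log M] and no width. *)
Lemma net_cell N E H (x : T -> R) (k : T -> nat) (g delta : R) :
  (0 < N)%N -> 0 < delta -> aff H x -> (forall t, 0 <= x t) ->
  spaced (fun t => Num.min (x t) (1 - delta)) k g delta ->
  (forall t, (k t < N * (N * 2 ^ (2 * E)))%N) ->
  net (2 * E + 3) (2 * N + 7) H [:: (fun t => (k t)%:R); x].
Proof.
move=> N0 d0 hx x0 hs hk; set y := fun t => _ in hs.
have y0 t : 0 <= y t by have [/(_ (leq0n _))] := hs t 0%N; rewrite mul0r.
have -> : (2 * E + 3 = 1 + (2 * E).+2)%N by lia.
apply: (@net_comp _ _ _ _ _ _ [:: y; x]).
  apply: (@net1c _ _ _ _ [:: fun t => x t - (1 - delta)] [:: x]).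
  - by rewrite /=; lia.
  - by move=> g'; rewrite inE => /eqP->; apply: affB => //; apply: AffCst.
  - by move=> g'; rewrite inE => /eqP->.
  - by move=> g'; rewrite inE => /eqP->.
  move=> f; rewrite !inE => /orP[]/eqP->; last first.
    by apply: AffMem; rewrite !inE eqxx orbT.
  apply: (@aff_ext _ _ _ (x \- rl (fun t => x t - (1 - delta)))).
    move=> t; rewrite /= /rl /y; case: (leP (x t) (1 - delta)) => h.
      by rewrite max_l ?subr0 // subr_le0.
    by rewrite max_r ?subr_ge0 ?(ltW h) // subKr.
  by apply: affB; apply: AffMem; rewrite !inE eqxx ?orbT.
have hF f : f \in [:: y; x] -> aff [:: y; x] f by apply: AffMem.
have -> : (2 * E).+2 = size ([:: N; N] ++ nseq (2 * E) 2%N) by rewrite /= size_nseq.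
apply: (@net_out _ _ _ _ _ [:: (fun t => 0 + (k t)%:R); x]).
  move=> f; rewrite !inE => /orP[]/eqP->.
    by apply: (aff_ext _ (AffMem (mem_head _ _))) => t; rewrite add0r.
  by apply: AffMem; rewrite !inE eqxx orbT.
apply: (@net_quant _ _ _ [:: x] delta g _ _ y (fun=> 0)) => //.
- move=> a; rewrite mem_cat mem_nseq !inE => /orP[/orP[]/eqP->|/andP[_ /eqP->]] /=; lia.
- by move=> t; rewrite !big_cons big_nseq iter_muln_1.
- by apply: hF; rewrite mem_head.
- exact: AffCst.
- by move=> h; rewrite inE => /eqP->; apply: hF; rewrite !inE eqxx orbT.
- by move=> h; rewrite inE => /eqP->.
Qed.

Lemma mixed_radix_lt (b n : nat) (k : nat -> nat) : (forall i, k i < b)%N ->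
  (\sum_(i < n) k i * b ^ i < b ^ n)%N.
Proof.
move=> kb; elim: n => [|n IH]; first by rewrite big_ord0.
rewrite big_ord_recr /= expnS.
apply: (@leq_trans (b ^ n + k n * b ^ n)); first by rewrite ltn_add2r.
by rewrite -mulSn leq_mul.
Qed.

Lemma mixed_radix_inj (b n : nat) (k k' : nat -> nat) :
  (forall i, k i < b)%N -> (forall i, k' i < b)%N ->
  (\sum_(i < n) k i * b ^ i = \sum_(i < n) k' i * b ^ i)%N ->
  forall i, (i < n)%N -> k i = k' i.
Proof.
move=> kb kb'; elim: n => [//|n IH].
rewrite !big_ord_recr /= => E.
have l1 := mixed_radix_lt n kb; have l2 := mixed_radix_lt n kb'.
have b0 : (0 < b ^ n)%N by apply: leq_ltn_trans l1.
have En : k n = k' n.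
  have := congr1 (fun c => c %/ b ^ n)%N E.
  by rewrite !divnDMl // !divn_small // !add0n.
move=> i; rewrite ltnS leq_eqVlt => /orP[/eqP -> //|]; apply: IH.
by move: E; rewrite En => /addIn.
Qed.

Lemma net_fiber N M E S P H (i : T -> nat) (v : T -> R) :
  (0 < N)%N -> (0 < M)%N -> (0 < S)%N -> (M <= 2 ^ E)%N ->
  (forall t, (i t < N * (N * (M * M)))%N) -> aff H (fun t => (i t)%:R) ->
  (forall t, 0 <= v t <= 1) -> (forall t t', i t = i t' -> v t = v t') ->
  exists w, net (E + M + 4 + 2 * M * S) (P * (3 * N + 6)) H [:: w] /\
    forall t, 0 <= w t <= 1 /\ `|v t - w t| <= (2 ^+ (P * S))^-1.
Proof.
move=> N0 M0 S0 ME iN hi v01 vi.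
have /choice[u hu] : forall c, exists u : R, 0 <= u <= 1 /\ forall t, i t = c -> v t = u.
  move=> c; case: (pselect (exists t, i t = c)) => [[t it]|nt].
    by exists (v t); split=> // t' it'; apply: vi; rewrite it it'.
  (* An index that belongs to no input gets the default value 0. *)
  by exists 0; split=> [|t it]; [rewrite lexx ler01|case: nt; exists t].
have [w [hw E1]] := net_points (u := u) P N0 M0 S0 ME iN hi (fun c => (hu c).1).
by exists w; split=> // t; rewrite ((hu (i t)).2 t erefl); exact: E1.
Qed.

Lemma net_monomial N M E S P m s Hs H (i : T -> nat) (v : T -> R) hs :
  (0 < N)%N -> (0 < M)%N -> (0 < S)%N -> (2 < P)%N -> (M <= 2 ^ E)%N ->
  (forall t, (i t < N * (N * (M * M)))%N) -> aff H (fun t => (i t)%:R) ->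
  (forall t, 0 <= v t <= 1) -> (forall t t', i t = i t' -> v t = v t') ->
  (forall h, h \in Hs -> aff H h) -> (forall h, h \in Hs -> forall t, 0 <= h t <= 1) ->
  {subset hs <= Hs} -> (size hs <= s)%N ->
  exists z, net (E + M + 4 + 2 * M * S + s * m.+1) (P * (3 * N + 6) + size Hs) H [:: z] /\
    forall t, `|z t - v t * \prod_(h <- hs) h t| <=
      s%:R * ((N.+1%:R ^- 2) ^+ m / 2) + (2 ^+ (P * S))^-1.
Proof.
move=> N0 M0 S0 P2 ME iN hi v01 vi hC C01 sub sz.
have [w [hw Ew]] := net_fiber P N0 M0 S0 ME iN hi v01 vi.
(* Short monomials are padded with factors 1, so that all of them take the same depth and can be
   computed in parallel. *)
pose hs' := hs ++ nseq (s - size hs) (fun=> 1 : R).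
have C0 h : h \in Hs -> forall t, 0 <= h t by move=> /C01 h01 t; have /andP[] := h01 t.
have [|||||z [hz Ez]] := @net_prods R T N m Hs hs' (w :: Hs) w _ _ _ C0.
- exact/AffMem/mem_head.
- by move=> t; case: (Ew t).
- by move=> h hh; apply: AffMem; rewrite inE hh orbT.
- move=> h; rewrite mem_cat => /orP[/sub|]; first exact: AffMem.
  by rewrite mem_nseq => /andP[_ /eqP->]; exact: AffCst.
- move=> h; rewrite mem_cat => /orP[/sub /C01 //|].
  by rewrite mem_nseq => /andP[_ /eqP->] t; rewrite ler01 lexx.
have sz' : size hs' = s by rewrite size_cat size_nseq subnKC.
exists z; split.
  apply: (@net_comp _ _ _ _ _ _ ([:: w] ++ Hs)).
    by apply: net_cat hw _; apply: net_carry.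
  rewrite -[s in (s * _)%N]sz'; apply: net_mono hz.
  by rewrite leq_add2r; nia.
move=> t; have := Ez t; rewrite sz' big_cat /=.
rewrite [X in _ * (_ * X)](_ : _ = 1) ?mulr1; last first.
  by rewrite big_seq big1 // => h; rewrite mem_nseq => /andP[_ /eqP->].
set Q := \prod_(h <- hs) h t => Ez1.
have Q01 : 0 <= Q <= 1.
  rewrite /Q big_seq; apply/andP; split.
    by apply: prodr_ge0 => g hg; apply: C0; apply: sub.
  by apply: prodr_ile1 => g hg; apply: C01; apply: sub.
rewrite -[z t](subrK (w t * Q)) -addrA -mulrBl.
apply: le_trans (ler_normD _ _) _; apply: lerD => //.
have /andP[Q0 Q1] := Q01; rewrite normrM (ger0_norm Q0) distrC.
have [_] := Ew t; apply: le_trans; exact: ler_piMr.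
Qed.

(** The index of a cell has the numbers [k i] as its digits in base [K]. It is affine in them, so it
    costs no layer, and it determines them, so every coefficient is a function of it. *)
Lemma net_taylor d N M E S P m s K (x : 'I_d -> T -> R) (k : 'I_d -> T -> nat)
    (terms : seq (R * seq 'I_d)) (c : R * seq 'I_d -> T -> R) (g delta : R) H :
  (0 < N)%N -> (0 < M)%N -> (0 < S)%N -> (2 < P)%N -> (M <= 2 ^ E)%N -> (0 < d)%N ->
  (K ^ d <= (M * N) ^ 2)%N -> 0 < delta ->
  (forall i, aff H (x i)) -> (forall i t, 0 <= x i t) ->
  (forall i t, (k i t < K)%N) ->
  (forall i, spaced (fun t => Num.min (x i t) (1 - delta)) (k i) g delta) ->
  (forall i t, 0 <= x i t - (k i t)%:R * g <= 1) ->
  (forall wl, wl \in terms -> 0 <= wl.1 <= 1 /\ (size wl.2 <= s)%N) ->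
  (forall wl t, wl \in terms -> `|c wl t| <= 1) ->
  (forall wl t t', (forall i, k i t = k i t') -> c wl t = c wl t') ->
  exists phi, net (2 * E + 3 + (E + M + 4 + 2 * M * S + s * m.+1))
      (maxn (d * (2 * N + 7)) (size terms * (2 * (P * (3 * N + 6) + d)))) H [:: phi] /\
    forall t, `|phi t - \sum_(wl <- terms)
        wl.1 * (\prod_(j <- wl.2) (x j t - (k j t)%:R * g)) * c wl t| <=
      (size terms)%:R * (2 * (s%:R * ((N.+1%:R ^- 2) ^+ m / 2) + (2 ^+ (P * S))^-1)).
Proof.
move=> N0 M0 S0 P2 ME d0 KMN delta0 hx x0 kK hs h01 hterms c1 ck.
pose kk (i : nat) t := if insub i is Some j then k j t else 0%N.
have kkE (i : 'I_d) t : kk i t = k i t by rewrite /kk valK.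
have kkK i t : (kk i t < K)%N.
  rewrite /kk; case: insubP => [j _ _|_]; first exact: kK.
  exact: leq_ltn_trans (kK (Ordinal d0) t).
pose idx t := (\sum_(i < d) kk i t * K ^ i)%N.
have idxN t : (idx t < N * (N * (M * M)))%N.
  apply: leq_trans (mixed_radix_lt d (fun i => kkK i t)) _.
  by apply: leq_trans KMN _; rewrite expnMn; nia.
have idx_inj t t' : idx t = idx t' -> forall i, k i t = k i t'.
  move=> E1 i; rewrite -!kkE.
  exact: (@mixed_radix_inj K d (kk ^~ t) (kk ^~ t') (fun i => kkK i t) (fun i => kkK i t') E1).
have kN i t : (k i t < N * (N * 2 ^ (2 * E)))%N.
  apply: leq_trans (kK i t) _; apply: leq_trans (_ : K ^ d <= _)%N.
    by rewrite -[leqLHS]expn1 leq_pexp2l // (leq_ltn_trans _ (kK i t)).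
  apply: leq_trans KMN _; rewrite expnMn mulnC mulnA leq_mul //.
  by rewrite mulnC expnM leq_exp2r.
pose F1 := flatten [seq [:: (fun t => (k i t)%:R : R); x i] | i <- enum 'I_d].
have n1 : net (2 * E + 3) (d * (2 * N + 7)) H F1.
  suff : net (2 * E + 3) (size (enum 'I_d) * (2 * N + 7)) H F1 by rewrite size_enum_ord.
  apply: net_bigcat => i _.
  exact: net_cell N0 delta0 (hx i) (x0 i) (hs i) (kN i).
pose hh (i : 'I_d) t := x i t - (k i t)%:R * g.
pose Hs := [seq hh i | i <- enum 'I_d].
have F1k i : aff F1 (fun t => (k i t)%:R).
  apply/AffMem/flattenP; exists [:: (fun t => (k i t)%:R : R); x i]; last exact: mem_head.
  by apply/mapP; exists i; rewrite ?mem_enum.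
have F1x i : aff F1 (x i).
  apply/AffMem/flattenP; exists [:: (fun t => (k i t)%:R : R); x i].
    by apply/mapP; exists i; rewrite ?mem_enum.
  by rewrite !inE eqxx orbT.
have F1idx : aff F1 (fun t => (idx t)%:R).
  apply: (@aff_ext _ _ _ (fun t => \sum_(i < d) (k i t)%:R * (K ^ i)%:R)).
    by move=> t; rewrite natr_sum; apply: eq_bigr => i _; rewrite kkE natrM.
  by apply: aff_sum => i; apply: aff_mul.
have F1h h : h \in Hs -> aff F1 h.
  by move=> /mapP[i _ ->]; apply: affB => //; apply: aff_mul.
have Hs01 h : h \in Hs -> forall t, 0 <= h t <= 1.
  by move=> /mapP[i _ ->] t; exact: h01.
have sHs : size Hs = d by rewrite size_map size_enum_ord.
set e := s%:R * _ + _.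
have mono wl : wl \in terms -> forall b : bool, exists z,
    net (E + M + 4 + 2 * M * S + s * m.+1) (P * (3 * N + 6) + d) F1 [:: z] /\
    forall t, `|z t - Num.max 0 ((-1) ^+ b * c wl t) * \prod_(j <- wl.2) hh j t| <= e.
  move=> hwl b; have [_ sl] := hterms wl hwl.
  have v01 t : 0 <= Num.max 0 ((-1) ^+ b * c wl t) <= 1.
    rewrite le_max lexx ge_max ler01 /=.
    have := c1 wl t hwl; rewrite ler_norml.
    by case: b; rewrite /= ?expr1 ?expr0; lra.
  have vi t t' : idx t = idx t' ->
      Num.max 0 ((-1) ^+ b * c wl t) = Num.max 0 ((-1) ^+ b * c wl t').
    by move=> /idx_inj /ck ->.
  have [||z [hz Ez]] := @net_monomial N M E S P m s Hs F1 idx _ [seq hh j | j <- wl.2]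
    N0 M0 S0 P2 ME idxN F1idx v01 vi F1h Hs01.
  - by move=> h /mapP[j _ ->]; apply/mapP; exists j; rewrite ?mem_enum.
  - by rewrite size_map.
  exists z; split; first by rewrite sHs in hz.
  by move=> t; have := Ez t; rewrite big_map.
(* The coefficients are split into positive and negative parts. *)
have /choice[Z hZ] : forall p : (R * seq 'I_d) * bool, exists z, p.1 \in terms ->
    net (E + M + 4 + 2 * M * S + s * m.+1) (P * (3 * N + 6) + d) F1 [:: z] /\
    forall t, `|z t - Num.max 0 ((-1) ^+ p.2 * c p.1 t) * \prod_(j <- p.1.2) hh j t| <= e.
  move=> [wl b]; case hwl : (wl \in terms); last by exists (fun=> 0).
  by have [z hz] := mono wl hwl b; exists z.
pose phi t := \sum_(wl <- terms) wl.1 * (Z (wl, false) t - Z (wl, true) t).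
exists phi; split.
  apply: net_comp (net_mono (leq_maxl _ _) n1) _; apply: net_mono (leq_maxr _ _) _.
  apply: (@net_out _ _ _ _ _
    (flatten [seq [:: Z (wl, false)] ++ [:: Z (wl, true)] | wl <- terms])).
    move=> f; rewrite inE => /eqP->; apply: aff_sum_in => wl hwl.
    apply: AffScale; apply: affB; apply/AffMem/flattenP;
      exists [:: Z (wl, false); Z (wl, true)]; rewrite ?inE ?eqxx ?orbT //;
      by apply/mapP; exists wl.
  apply: net_bigcat => wl hwl; rewrite (mul2n (_ + d)) -addnn.
  by apply: net_cat; [have [] := hZ (wl, false) hwl|have [] := hZ (wl, true) hwl].
move=> t; rewrite -sumrB; apply: le_trans (ler_norm_sum _ _ _) _.
rewrite mulr_natl -sum1_size -sumrMnr big_seq [leRHS]big_seq.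
apply: ler_sum => wl hwl; rewrite mulr1n.
have [_ /(_ t) /= z1] := hZ (wl, false) hwl; have [_ /(_ t) /= z2] := hZ (wl, true) hwl.
have [/andP[w0 w1] _] := hterms wl hwl.
rewrite -mulrA -mulrBr normrM (ger0_norm w0).
have cE : c wl t = Num.max 0 ((-1) ^+ 0 * c wl t) - Num.max 0 ((-1) ^+ 1 * c wl t).
  by rewrite expr0 expr1 mul1r mulN1r; case: (leP 0 (c wl t)); case: (leP 0 (- c wl t)); lra.
rewrite {}cE; move: z1 z2; rewrite -/(hh _ _).
set Q := \prod_(j <- _) _; move: (Num.max _ _) (Num.max _ _) (Z _ t) (Z _ t) => v1 v2 u1 u2.
rewrite !ler_norml => z1 z2; apply: le_trans (ler_piMl _ w1) _ => //.
by rewrite ler_norml mulrBr ![Q * _]mulrC; lra.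
Qed.

End TaylorNet.

(** * Numerical estimates *)

Section Arithmetic.
Context {R : realType}.
Implicit Types (x : R) (n d s M N K : nat).

Lemma natceil_ge x : 0 <= x -> x <= (natceil x)%:R.
Proof.
move=> x0; have c0 : (0 <= Num.ceil x)%R by rewrite ceil_ge0 // (lt_le_trans _ x0) ?ltrN10.
rewrite /natceil pmulrn gez0_abs //; exact: ceil_ge.
Qed.

Lemma natceil_lt x : 0 <= x -> (natceil x)%:R < x + 1.
Proof.
move=> x0; have c0 : (0 <= Num.ceil x)%R by rewrite ceil_ge0 // (lt_le_trans _ x0) ?ltrN10.
by rewrite /natceil pmulrn gez0_abs // -ltrBlDr -[1]/(1%:~R) -intrB gt_pred_ceil.
Qed.

Lemma natceil_log2 n : (0 < n)%N ->
  let L := natceil (log2 (8 * n%:R : R)) in (3 <= L)%N /\ (n <= 2 ^ (L - 3))%N.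
Proof.
move=> n0 L; have n8 : (1 : R) <= 8 * n%:R by rewrite -natrM ler1n muln_gt0.
have ln20 : 0 < ln (2 : R) by rewrite ln_gt0 // ltr1n.
have lg0 : 0 <= log2 (8 * n%:R : R) by apply: divr_ge0; [exact: ln_ge0|exact: ltW].
have : (8 * n <= 2 ^ L)%N.
  rewrite -(ler_nat R) natrM natrX -ler_ln ?posrE ?exprn_gt0 //; last first.
    by rewrite (lt_le_trans ltr01).
  by rewrite lnXn // -[_ *+ L]mulr_natl -ler_pdivrMr //; exact: natceil_ge.
have [L3|L3] := leqP 3 L.
  by rewrite -{1}(subnKC L3) expnD leq_pmul2l.
move=> h; have : (2 ^ L <= 2 ^ 2)%N by rewrite leq_exp2l.
by move=> /(leq_trans h); rewrite -[(2 ^ 2)%N]/4%N; lia.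
Qed.

(** Rounding up may push [K ^ d] above [(M N)^2]. Halving undoes this: for [K >= 3],
    [uphalf K <= K - 1], which is below the unrounded power, and for [K <= 2] it is 1. *)
Lemma uphalf_natceil_exp_le M N d K : (0 < d)%N -> (0 < M)%N -> (0 < N)%N ->
  K = natceil ((M * N)%:R `^ (2 / d%:R) : R) ->
  ((uphalf K) ^ d <= (M * N) ^ 2)%N /\ (0 < K)%N.
Proof.
move=> d0 M0 N0 KE; set X := _ `^ _ in KE.
have MN1 : (1 : R) <= (M * N)%:R by rewrite ler1n muln_gt0 M0.
have X1 : 1 <= X.
  by rewrite -[leLHS](powRr0 (M * N)%:R) ler_powR // divr_ge0.
have X0 : 0 <= X by rewrite (le_trans ler01).
have KX : K%:R < X + 1 by rewrite KE; exact: natceil_lt.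
have XK : X <= K%:R by rewrite KE; exact: natceil_ge.
have K0 : (0 < K)%N by rewrite -(ltr_nat R) (lt_le_trans ltr01 (le_trans X1 XK)).
split=> //; have hK : (uphalf K)%:R <= X.
  have [K2|K2] := leqP K 2.
    by apply: le_trans X1; rewrite lern1; case: K K2 K0 {KE KX XK} => [|[|[]]].
  have : (uphalf K <= K.-1)%N by rewrite uphalfE; lia.
  rewrite -(ler_nat R) => /le_trans -> //; rewrite -subn1 natrB //; lra.
rewrite -(ler_nat R) !natrX; apply: le_trans (_ : X ^+ d <= _).
  by rewrite lerXn2r ?nnegrE.
by rewrite /X -powR_mulrn ?powR_ge0 // -powRrM divfK ?pnatr_eq0 -?lt0n // powR_mulrn ?ler0n.
Qed.

(** Cells of side [2 / K]; the minimum with [1 - delta] keeps [x = 1] away from the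
    threshold [uphalf K * (2 / K) >= 1], at which no cell starts. *)
Lemma grid_cell K (delta x : R) : (0 < K)%N -> 0 < delta -> delta <= 1 / (3 * K%:R) ->
  0 <= x <= 1 ->
  (forall c, (1 <= c <= K.-1)%N -> ~ (c%:R / K%:R - delta < x < c%:R / K%:R)) ->
  exists k, [/\ (k < uphalf K)%N,
    forall c, ((c <= k)%N -> c%:R * (2 / K%:R) <= Num.min x (1 - delta) :> R) /\
      ((k < c)%N -> Num.min x (1 - delta) <= c%:R * (2 / K%:R) - delta),
    (k%:R : R) * (2 / K%:R) <= 1,
    0 <= x - k%:R * (2 / K%:R) <= 2 / K%:R & x - k%:R * (2 / K%:R) <= 1].
Proof.
move=> K0 d0 dK /andP[x0 x1] hx.
have KR : (0 : R) < K%:R by rewrite ltr0n.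
have dK1 : delta <= 1 / K%:R.
  by apply: le_trans dK _; rewrite ler_pdivlMr // mulrC mulrA mulr1 ler_pdivrMr; nra.
have gE c : c%:R * (2 / K%:R) = (2 * c)%:R / K%:R :> R by rewrite natrM mulrA mulrC [2 * _]mulrC mulrC.
pose P k := (k < uphalf K)%N && (k%:R * (2 / K%:R) <= x).
have exP : exists k, P k by exists 0%N; rewrite /P mul0r x0 uphalf_gt0 K0.
have bP k : P k -> (k <= uphalf K)%N by move=> /andP[/ltnW].
case: (ex_maxnP exP bP) => k /andP[kK kx] kmax.
have lt_half c : (c < uphalf K)%N -> (2 * c <= K.-1)%N by rewrite uphalfE; lia.
have ge_half c : (uphalf K <= c)%N -> 1 <= c%:R * (2 / K%:R) :> R.
  by rewrite gE ler_pdivlMr // mul1r ler_nat uphalfE; lia.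
have lt_half1 c : (c < uphalf K)%N -> c%:R * (2 / K%:R) <= 1 - delta.
  move=> /lt_half cK; have : (2 * c)%:R <= K%:R - 1 :> R.
    by rewrite lerBrDr -(natrD _ _ 1) ler_nat; lia.
  rewrite gE => h; apply: le_trans (_ : (K%:R - 1) / K%:R <= _).
    by rewrite ler_pM2r ?invr_gt0.
  by rewrite mulrBl divff ?lt0r_neq0 //; lra.
have up c : (k < c)%N -> Num.min x (1 - delta) <= c%:R * (2 / K%:R) - delta.
  move=> kc; have [cK|cK] := ltnP c (uphalf K); last first.
    by apply: le_trans (_ : 1 - delta <= _); [rewrite ge_min lexx orbT|rewrite lerD2r ge_half].
  have xc : x < c%:R * (2 / K%:R).
    by rewrite ltNge; apply/negP => h; have := kmax c; rewrite /P cK h => /(_ isT); rewrite leqNgt kc.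
  apply: le_trans (_ : x <= _); first by rewrite ge_min lexx.
  (* The threshold is the interior grid point [2 c / K], so [hx] excludes the gap of width [delta]
     to its left. *)
  have [//|h] := leP x (c%:R * (2 / K%:R) - delta).
  by case: (hx (2 * c)%N); rewrite -?gE ?h ?xc // lt_half // muln_gt0 (leq_ltn_trans _ kc).
have le2 : x - k%:R * (2 / K%:R) <= 2 / K%:R.
  have := up _ (ltnSn k); rewrite -natr1 mulrDl mul1r.
  by case: (leP x (1 - delta)); lra.
exists k; split=> //.
- move=> c; split=> [ck|]; last exact: up.
  have ck' : c%:R * (2 / K%:R) <= k%:R * (2 / K%:R) :> R.
    by rewrite ler_pM2r ?divr_gt0 // ler_nat.
  by rewrite le_min !(le_trans ck') // lt_half1.
- exact: le_trans kx x1.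
- by rewrite subr_ge0 kx.
(* For [K = 1] the side [2 / K] exceeds 1; this separate bound keeps the factors of the monomials in
   [0, 1]. *)
- by rewrite lerBlDr (le_trans x1) // lerDl mulr_ge0 // divr_ge0.
Qed.

(** Here products of logarithms replace sums: [(N + 1) ^ (E + 1) >= N * 2 ^ E >= N * M], and
    [a * (E + 3) >= 2 * ((a - 3) + E)] since [a >= 3]. *)
Lemma precision M N s E a :
  (0 < M)%N -> (0 < N)%N -> (M <= 2 ^ E)%N -> (3 <= a)%N -> (N <= 2 ^ (a - 3))%N ->
  let Q : R := ((N * M)%:R ^+ (2 * (s + 1)))^-1 in
  (N.+1%:R ^- 2) ^+ ((s + 1) * (E + 1)) <= Q /\
  (2 ^+ (a * ((s + 1) * (E + 3))))^-1 <= Q.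
Proof.
move=> M0 N0 ME a3 Na Q.
have NM0 : (0 < (N * M) ^ (2 * (s + 1)))%N by rewrite expn_gt0 muln_gt0 N0 M0.
have inv_le (p q : nat) : (0 < p)%N -> (p <= q)%N -> q%:R^-1 <= p%:R^-1 :> R.
  by move=> p0 pq; rewrite lef_pV2 ?posrE ?ltr0n ?ler_nat // (leq_trans p0).
rewrite /Q; split.
  rewrite exprVn -exprM -!natrX; apply: inv_le NM0 _.
  have -> : (N.+1 ^ (2 * ((s + 1) * (E + 1))) = (N.+1 ^ (E + 1)) ^ (2 * (s + 1)))%N.
    by rewrite -expnM mulnA mulnC.
  rewrite leq_exp2r ?muln_gt0 ?addn1 // expnS leq_mul //.
  by apply: leq_trans ME _; case: E => // E'; rewrite leq_exp2r.
rewrite -!natrX; apply: inv_le NM0 _.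
have -> : (2 ^ (a * ((s + 1) * (E + 3))) = (2 ^ (a * (E + 3))) ^ (s + 1))%N.
  by rewrite -expnM mulnCA mulnC.
rewrite expnM leq_exp2r ?addn1 //.
apply: leq_trans (_ : (2 ^ (a - 3) * 2 ^ E) ^ 2 <= _)%N.
  by rewrite leq_exp2r // leq_mul.
by rewrite -expnD -expnM leq_exp2l //; nia.
Qed.

Lemma depth_bound s M E : (0 < M)%N ->
  (2 * E + 3 + (E + M + 4 + 2 * M * ((s + 1) * (E + 3)) + s * ((s + 1) * (E + 1)).+1)
    <= 21 * (s + 1) ^ 2 * M * (E + 3))%N.
Proof.
move=> M0; have h1 : (E + 3 <= M * (E + 3))%N by rewrite leq_pmull.
have h2 : (M * (E + 3) <= (s + 1) * (M * (E + 3)))%N by rewrite leq_pmull ?addn1.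
have h3 : ((s + 1) * (M * (E + 3)) <= (s + 1) ^ 2 * (M * (E + 3)))%N.
  by rewrite leq_mul // -[leqLHS]expn1 leq_pexp2l ?addn1.
have h4 : (s * ((s + 1) * (E + 1)).+1 <= 2 * ((s + 1) ^ 2 * (M * (E + 3))))%N.
  apply: leq_trans (_ : 2 * ((s + 1) ^ 2 * (E + 3)) <= _)%N; first nia.
  by rewrite !leq_mul.
have h5 : (M <= M * (E + 3))%N by rewrite leq_pmulr // addn3.
rewrite -!mulnA (mulnCA M); lia.
Qed.

Lemma width_bound s d N P t : (0 < d)%N -> (0 < N)%N -> (2 < P)%N ->
  (t <= s.+1 * d ^ s)%N ->
  (maxn (d * (2 * N + 7)) (t * (2 * (P * (3 * N + 6) + d)))
    <= 38 * (s + 1) ^ 2 * d ^ (s + 1) * N * P)%N.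
Proof.
move=> d0 N0 P2 ht.
have dP : (d <= d ^ (s + 1))%N by rewrite addn1 -[leqLHS]expn1 leq_pexp2l.
have s1 : (s + 1 <= (s + 1) ^ 2)%N by rewrite -[leqLHS]expn1 leq_pexp2l ?addn1.
have NP : (N <= N * P)%N by rewrite leq_pmulr // ltnW // ltnW.
rewrite geq_max; apply/andP; split.
  apply: leq_trans (_ : 38 * 1 * d ^ (s + 1) * N * P <= _)%N.
    rewrite -!mulnA mul1n (mulnCA 38) leq_mul //; nia.
  by rewrite !leq_mul // (leq_trans _ s1) ?addn1.
apply: leq_trans (leq_mul ht (leqnn _)) _.
apply: leq_trans (_ : 38 * (s + 1) * d ^ (s + 1) * N * P <= _)%N; last by rewrite !leq_mul.
rewrite addn1 expnS.
have -> : (38 * s.+1 * (d * d ^ s) * N * P = s.+1 * d ^ s * (38 * (d * (N * P))))%N by lia.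
rewrite leq_mul //.
have h1 : (N * P <= d * (N * P))%N by rewrite leq_pmull.
have h2 : (d <= d * (N * P))%N by rewrite leq_pmulr // muln_gt0 N0 (leq_trans _ P2).
have h3 : (P <= N * P)%N by rewrite leq_pmull.
by rewrite mulnDr mulnCA; lia.
Qed.

(** The 4 bounds [2 ^ (s + 1) / s!], attained at [s = 1] and [s = 2]. The power of [d] that arises
    is [s + r / 2], and [r <= 1]. *)
Lemma taylor_error_bound s d K (r X : R) : (0 < d)%N -> 0 < r <= 1 -> 0 < X -> X <= K%:R ->
  (Num.sqrt d%:R * (2 / K%:R)) `^ r * (d%:R * (2 / K%:R)) ^+ s / s`!%:R <=
  4 * (d%:R `^ (s%:R + Num.max (s%:R + r) 1 / 2) * X `^ (- (s%:R + r))).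
Proof.
move=> d0 /andP[r0 r1] X0 XK.
have d1 : (1 : R) <= d%:R by rewrite ler1n.
have K0 : (0 : R) < K%:R by apply: lt_le_trans XK.
have iK : 2 / K%:R <= 2 / X by rewrite ler_pM2l // lef_pV2 ?posrE.
apply: le_trans (_ : (Num.sqrt d%:R * (2 / X)) `^ r * (d%:R * (2 / X)) ^+ s / s`!%:R <= _).
  rewrite ler_wpM2r ?invr_ge0 // ler_pM ?powR_ge0 ?exprn_ge0 ?mulr_ge0 ?invr_ge0 ?(ltW K0) //.
    rewrite ge0_ler_powR ?nnegrE ?mulr_ge0 ?sqrtr_ge0 ?invr_ge0 ?(ltW X0) ?(ltW K0) ?(ltW r0) //.
    by rewrite ler_wpM2l ?sqrtr_ge0.
  rewrite lerXn2r ?nnegrE ?mulr_ge0 ?invr_ge0 ?(ltW X0) ?(ltW K0) //.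
  by rewrite ler_wpM2l.
have sq0 : 0 <= Num.sqrt (d%:R : R) by exact: sqrtr_ge0.
rewrite !powRM ?mulr_ge0 ?invr_ge0 ?(ltW X0) // !exprMn.
have Xr : X^-1 `^ r * X^-1 ^+ s = X `^ (- (s%:R + r)).
  rewrite -powR_mulrn ?invr_ge0 ?(ltW X0) // -powRD; last by rewrite invr_eq0 (gt_eqF X0) implybT.
  by rewrite -powR_inv1 ?(ltW X0) // -powRrM mulN1r [r + _]addrC.
have dd : Num.sqrt (d%:R : R) `^ r * d%:R ^+ s <= d%:R `^ (s%:R + Num.max (s%:R + r) 1 / 2).
  rewrite -powR12_sqrt // -powRrM -powR_mulrn // -powRD; last by rewrite (gt_eqF (lt_le_trans ltr01 d1)) implybT.
  rewrite ler_powR //; have : r <= Num.max (s%:R + r) 1 by rewrite le_max r1 orbT.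
  lra.
have two : 2 `^ r * 2 ^+ s / s`!%:R <= 4 :> R.
  have r2 : 2 `^ r <= 2 :> R by rewrite -[leRHS]powRr1 // ler_powR // ler1n.
  apply: le_trans (_ : 2 * 2 ^+ s / s`!%:R <= _).
    by rewrite ler_wpM2r ?invr_ge0 // ler_wpM2r // exprn_ge0.
  rewrite ler_pdivrMr ?ltr0n ?fact_gt0 // -exprS -natrX -natrM ler_nat expnS.
  elim: s {Xr dd} => [//|[//|s] IH]; rewrite expnS factS; move: IH; nia.
rewrite -Xr; set A := Num.sqrt _ `^ r in dd *; set D := _ `^ _ in dd *.
have -> : A * (2 `^ r * X^-1 `^ r) * (d%:R ^+ s * (2 ^+ s * X^-1 ^+ s)) / s`!%:R =
   (2 `^ r * 2 ^+ s / s`!%:R) * ((A * d%:R ^+ s) * (X^-1 `^ r * X^-1 ^+ s)) by ring.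
have A0 : 0 <= A by exact: powR_ge0.
have X10 : 0 <= X^-1 `^ r * X^-1 ^+ s.
  by rewrite mulr_ge0 ?powR_ge0 ?exprn_ge0 ?invr_ge0 ?(ltW X0).
apply: ler_pM => //.
- by apply: mulr_ge0 => //; rewrite mulr_ge0 ?exprn_ge0.
- exact: ler_wpM2r.
Qed.

End Arithmetic.

(** * Assembly of the network and its total error *)

Lemma size_taylor_terms_le (R : realType) (d s : nat) : (0 < d)%N ->
  (size (taylor_terms (R := R) (rev (enum 'I_d)) s) <= s.+1 * d ^ s)%N.
Proof.
move=> d0; have : size (rev (enum 'I_d)) = d by rewrite size_rev size_enum_ord.
case: (rev _) => [E|i cs E]; first by rewrite -E in d0.
have E' : (size cs).+1 = d by exact: E.
by have := size_taylor_terms (R := R) i cs s; rewrite E'.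
Qed.

Theorem theorem3p3 (R : realType) (d s M N K : nat) (beta r B0 delta : R)
    (f : 'cV[R]_d -> R) :
  (0 < d)%N -> 0 < B0 -> 0 < r <= 1 -> beta = s%:R + r ->
  holder_class d s r B0 f ->
  (0 < M)%N -> (0 < N)%N ->
  K = natceil ((M * N)%:R `^ (2 / d%:R) : R) ->
  0 < delta <= 1 / (3 * K%:R) ->
  exists phi0 : 'cV[R]_d -> R,
    relu_implements
      (38 * (s + 1) ^ 2 * d ^ (s + 1) * N * natceil (log2 (8 * N%:R : R)))%N
      (21 * (s + 1) ^ 2 * M * natceil (log2 (8 * M%:R : R)))%N
      phi0 /\
    forall x, (cube d `\` trifling_region d K delta) x ->
      `|f x - phi0 x| <=
        18 * B0 * (s + 1)%:R ^+ 2 * d%:R `^ (s%:R + Num.max beta 1 / 2) *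
        (N * M)%:R `^ (- (2 * beta) / d%:R).
Proof.
move=> d0 B0p r01 betaE hf M0 N0 KE /andP[delta0 deltaK].
have B00 := ltW B0p; have /andP[r0 r1] := r01.
have [Kexp K0] := uphalf_natceil_exp_le d0 M0 N0 KE.
have [LM3] := natceil_log2 (R := R) M0; set LM := natceil _ in LM3 * => ME.
have [LN3] := natceil_log2 (R := R) N0; set LN := natceil _ in LN3 * => NE.
set W := (38 * _ * _ * _ * _)%N; set D := (21 * _ * _ * _)%N.
set E := (LM - 3)%N in ME; have LME : LM = (E + 3)%N by rewrite subnK.
(* Inputs are restricted to the good points, where all identities between neurons hold exactly; the
   parameters found there define [phi0] on the whole space. *)
pose T := {x : 'cV[R]_d | (cube d `\` trifling_region d K delta) x}.
pose g : R := 2 / K%:R.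
have /choice[k hk] : forall p : 'I_d * T, exists k : nat,
   [/\ (k < uphalf K)%N,
    forall c, ((c <= k)%N -> c%:R * g <= Num.min (sval p.2 p.1 0) (1 - delta) :> R) /\
      ((k < c)%N -> Num.min (sval p.2 p.1 0) (1 - delta) <= c%:R * g - delta),
    (k%:R : R) * g <= 1,
    0 <= sval p.2 p.1 0 - k%:R * g <= g & sval p.2 p.1 0 - k%:R * g <= 1].
  move=> [i [x [cx tx]]] /=; apply: grid_cell => // c hc hlt.
  by apply: tx; exists i => //; split=> //; exists c.
have g0 : 0 <= g by rewrite divr_ge0.
pose corner (t : T) : 'cV[R]_d := \col_i ((k (i, t))%:R * g).
have ccorner t : cube d (corner t).
  by move=> i; rewrite mxE; have [_ _ -> _ _] := hk (i, t); rewrite mulr_ge0.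
set terms := taylor_terms (R := R) (rev (enum 'I_d)) s.
have szterms : (size terms <= s.+1 * d ^ s)%N by exact: size_taylor_terms_le.
(* Division by [B0] brings the coefficients into [-1, 1]; the final affine map multiplies by [B0]
   again. *)
pose c (wl : R * seq 'I_d) (t : T) := partials wl.2 f (corner t) / B0.
pose S := ((s + 1) * LM)%N; pose m := ((s + 1) * (E + 1))%N.
have S0 : (0 < S)%N by rewrite muln_gt0 addn1 (leq_trans _ LM3).
pose xx (i : 'I_d) (t : T) := sval t i 0.
pose H := coords (fun t : T => sval t).
have hx i : aff H (xx i) by apply: AffMem; exact: coords_mem.
have x0 i t : 0 <= xx i t by have /andP[] := (svalP t).1 i.
have [||||||phi [hn Ephi]] := @net_taylor R T d N M E S LN m s (uphalf K) xx
    (fun i t => k (i, t)) terms c g delta H N0 M0 S0 LN3 ME d0 Kexp delta0 hx x0.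
- by move=> i t; case: (hk (i, t)).
- by move=> i t; case: (hk (i, t)).
- by move=> i t; have [_ _ _ /andP[-> _] ->] := hk (i, t).
- by move=> wl; exact: taylor_termsP.
- move=> wl t hwl; rewrite /c normrM [`|B0^-1|]gtr0_norm ?invr_gt0 // ler_pdivrMr // mul1r.
  exact: (taylor_terms_partials_le hf (ccorner t) hwl).
- move=> wl t t' kk; rewrite /c; congr (partials _ _ _ / _).
  by apply/colP => i; rewrite !mxE kk.
have W0 : (0 < W)%N by rewrite !muln_gt0 !expn_gt0 addn1 d0 N0 (leq_trans _ LN3).
have W2 : (2 <= W)%N.
  rewrite /W -!mulnA; apply: leq_trans (leq_pmulr 38 _) => //.
  by rewrite !muln_gt0 !expn_gt0 addn1 d0 N0 (leq_trans _ LN3).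
have hD := depth_bound s E M0; rewrite -LME -/D -/S -/m in hD.
have hW : (maxn (d * (2 * N + 7)) (size terms * (2 * (LN * (3 * N + 6) + d))) <= W)%N.
  exact: width_bound.
have hn' : net D W H [:: fun t => B0 * phi t].
  rewrite -(subnKC hD); apply: net_pad => //.
  apply: (net_out _ (net_mono hW hn)) => h; rewrite inE => /eqP->.
  exact/AffScale/AffMem/mem_head.
have [nt Ent] := net_relu_net hn'.
exists (relu_eval nt); split.
  apply: relu_implements_nseq => //.
  by rewrite /D !muln_gt0 addn1 M0 (leq_trans _ LM3).
move=> x Gx; pose t : T := exist _ x Gx; rewrite -(Ent t : _ = relu_eval nt x).
have cx : cube d x by have [] := Gx.
have hdist i : 0 <= x i 0 - corner t i 0 <= g.
  by rewrite mxE; have [_ _ _ + _] := hk (i, t).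
have T1 := taylor_holder r0 hf B00 (ccorner t) cx hdist g0.
have := Ephi t; have [e1 e2] := precision (R := R) s M0 N0 ME LN3 NE.
move: e1 e2; rewrite -/m -LME -/S; set Q := (_ ^+ (2 * _))^-1 => e1 e2 E2.
set Y := _ `^ (- _ / _); set Dp := _ `^ (s%:R + _).
have NM1 : (1 : R) <= (N * M)%:R by rewrite ler1n muln_gt0 N0.
have d1 : (1 : R) <= d%:R by rewrite ler1n.
(* The exponent [2 * (s + 1)] in [Q] suffices in every dimension, as [beta <= s + 1] and
   [d >= 1]. *)
have QY : Q <= Y.
  rewrite /Q -powR_mulrn ?ler0n // -powRN; apply: ler_powR => //.
  rewrite mulNr lerN2 ler_pdivrMr ?(lt_le_trans ltr01) // natrM natrD betaE.
  have aux (a b q : R) : q <= 1 -> a + 1 <= (a + 1) * b -> 2 * (a + q) <= 2 * (a + 1) * b.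
    by clear; lra.
  by apply: aux => //; rewrite ler_peMr // addr_ge0.
have Dd : d%:R ^+ s <= Dp.
  rewrite -powR_mulrn // ler_powR // lerDl divr_ge0 // le_max ler01 orbT //.
have Y0 : 0 <= Y by exact: powR_ge0.
have XY : ((M * N)%:R `^ (2 / d%:R)) `^ (- (s%:R + r)) = Y.
  by rewrite -powRrM /Y [(N * M)%N]mulnC betaE; congr (_ `^ _); rewrite mulrAC mulrN mulNr.
have MN0 : (0 : R) < (M * N)%:R by rewrite mulnC (lt_le_trans ltr01).
have T2 := @taylor_error_bound R s d K r _ d0 r01 (powR_gt0 (2 / d%:R) MN0).
have XK : (M * N)%:R `^ (2 / d%:R) <= K%:R :> R.
  by rewrite KE; apply: natceil_ge; exact: powR_ge0.
have {}T2 := T2 XK; rewrite XY -betaE -/Dp in T2.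
have D0 : 0 <= Dp by exact: powR_ge0.
set A2 : R := (s + 1)%:R.
have A1 : 1 <= A2 by rewrite ler1n addn1.
(* One factor [A2] counts the Taylor terms, the other covers [s] products and one truncation, and
   the 2 comes from the splitting by sign. *)
have E3 : (size terms)%:R * (2 * (s%:R * ((N.+1%:R ^- 2) ^+ m / 2) + (2 ^+ (LN * S))^-1))
    <= 2 * A2 ^+ 2 * (Dp * Y).
  have sz : (size terms)%:R <= A2 * Dp.
    apply: le_trans (_ : (s.+1 * d ^ s)%:R <= _); first by rewrite ler_nat.
    by rewrite natrM natrX /A2 addn1 ler_wpM2l.
  have Q0 : 0 <= Q by rewrite invr_ge0 exprn_ge0.
  have in1 : 2 * (s%:R * ((N.+1%:R ^- 2) ^+ m / 2) + (2 ^+ (LN * S))^-1) <= 2 * (A2 * Y).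
    rewrite ler_pM2l // /A2 natrD mulrDl mul1r lerD ?(le_trans e2) //.
    rewrite ler_wpM2l // (le_trans _ QY) // (le_trans _ e1) // ler_piMr //.
    by rewrite invf_le1 // ler1n.
  apply: le_trans (ler_pM _ _ sz in1) _ => //.
  by rewrite le_eqVlt; apply/orP; left; apply/eqP; ring.
pose Tay := \sum_(wl <- terms) wl.1 *
  (\prod_(j <- wl.2) (x j 0 - corner t j 0)) * partials wl.2 f (corner t).
have TayE : Tay = B0 * \sum_(wl <- terms) wl.1 *
    (\prod_(j <- wl.2) (xx j t - (k (j, t))%:R * g)) * c wl t.
  rewrite mulr_sumr; apply: eq_bigr => wl _; rewrite /c.
  have -> : \prod_(j <- wl.2) (x j 0 - corner t j 0) =
      \prod_(j <- wl.2) (xx j t - (k (j, t))%:R * g).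
    by apply: eq_bigr => j _; rewrite mxE.
  by rewrite [RHS]mulrCA [B0 * _]mulrC divfK ?lt0r_neq0.
rewrite -[f x](subrK Tay) -addrA; apply: le_trans (ler_normD _ _) _.
have T3 : `|f x - Tay| <= B0 * (4 * (Dp * Y)).
  by apply: le_trans T1 _; rewrite -!(mulrA B0) ler_wpM2l.
have T4 : `|Tay - B0 * phi t| <= B0 * (2 * A2 ^+ 2 * (Dp * Y)).
  rewrite TayE -mulrBr normrM (ger0_norm B00) ler_wpM2l // distrC.
  exact: le_trans E2 E3.
have -> : 18 * B0 * A2 ^+ 2 * Dp * Y = 18 * A2 ^+ 2 * (B0 * (Dp * Y)) by ring.
apply: le_trans (lerD T3 T4) _.
have -> : B0 * (4 * (Dp * Y)) + B0 * (2 * A2 ^+ 2 * (Dp * Y)) =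
  (4 + 2 * A2 ^+ 2) * (B0 * (Dp * Y)) by ring.
rewrite ler_wpM2r ?mulr_ge0 //.
have aux (a : R) : 1 <= a -> 4 + 2 * a <= 18 * a by clear; lra.
exact/aux/exprn_ege1.
Qed.
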